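(* For each $n\ge 1$ let $A=(A_{ij})_{i,j=1}^n$ be a random matrix whose entries are independent and uniformly distributed on $\{+1,-1\}$, and let $\Delta_{cl}=\Delta_{cl}(A)$ be the classical value of the 2-player XOR game with matrix $A$ and uniformly distributed questions. Let $$c=\frac{2+2e^{-1/\pi}+(2+\pi)\,\mathrm{Erf}\left(1/\sqrt\pi\right)}{2\sqrt{2\pi}}=1.2789\ldots$$ Then, with probability $1-o(1)$ as $n\to\infty$, $$\frac{c-o(1)}{\sqrt n}\ \le\ \Delta_{cl}\ \le\ \frac{2\sqrt{\ln 2}+o(1)}{\sqrt n}=\frac{1.6651\ldots+o(1)}{\sqrt n}.$$ That is, for every $\epsilon>0$, $\Pr\left[\,c-\epsilon\le\sqrt n\,\Delta_{cl}\le 2\sqrt{\ln2}+\epsilon\,\right]\to1$ as $n\to\infty$.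
   Context: In the 2-player XOR game given by a matrix $A\in\{\pm1\}^{n\times n}$ with uniform questions, a referee picks $(i,j)\in\{1,\dots,n\}^2$ uniformly at random and sends $i$ to the first player and $j$ to the second; the players, who cannot communicate but may share random bits, answer with bits $x,y\in\{0,1\}$. They win if $x=y$ when $A_{ij}=1$, respectively $x\ne y$ when $A_{ij}=-1$. The classical value $\Delta_{cl}$ is the maximum over classical strategies of the winning probability minus the losing probability; it equals (and may be taken as defined by) $$\Delta_{cl}(A)=\max_{u_1,\dots,u_n\in\{-1,1\}}\ \max_{v_1,\dots,v_n\in\{-1,1\}}\ \frac1{n^2}\sum_{i,j=1}^nA_{ij}u_iv_j.$$ Here $\mathrm{Erf}(z)=\frac{2}{\sqrt\pi}\int_0^z e^{-t^2}\,dt$. *)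

(* Defs.v *)
From HB Require Import structures.
From mathcomp Require Import all_boot all_order all_algebra.
From mathcomp Require Import all_classical all_reals all_analysis.

Set Implicit Arguments.
Unset Strict Implicit.
Unset Printing Implicit Defensive.

Import Order.TTheory GRing.Theory Num.Theory.
Import numFieldNormedType.Exports.

Local Open Scope classical_set_scope.
Local Open Scope ring_scope.

(* The second integral is the orientation correction for z < 0. *)
Definition Erf (R : realType) (z : R) : R :=
  2 / Num.sqrt pi *
  (\int[lebesgue_measure]_(t in `[0, z]) expR (- t ^+ 2) -
   \int[lebesgue_measure]_(t in `[z, 0]) expR (- t ^+ 2)).

(* The answer bit b stands for the sign (-1) ^+ b, so that
   A i j * (-1) ^+ u i * (-1) ^+ v j is 1 when the answers u i, v j win on the
   questions (i, j), and -1 when they lose. *)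
Definition xor_bias (R : realType) (n : nat) (A : 'M[R]_n)
    (u v : {ffun 'I_n -> bool}) : R :=
  (n%:R ^+ 2)^-1 *
  \sum_(i < n) \sum_(j < n) A i j * (-1) ^+ (u i) * (-1) ^+ (v j).

(* \big[Num.max/x] needs an initial value x; taking the bias of the all-zero
   answers, itself one of the terms, makes this the maximum over all pairs
   (see classical_value_max). *)
Definition classical_value (R : realType) (n : nat) (A : 'M[R]_n) : R :=
  \big[Num.max/xor_bias A [ffun=> false] [ffun=> false]]_
    (s : {ffun 'I_n -> bool} * {ffun 'I_n -> bool}) xor_bias A s.1 s.2.

Lemma classical_value_max (R : realType) (n : nat) (A : 'M[R]_n) :
  (forall u v, xor_bias A u v <= classical_value A) /\
  (exists u v, classical_value A = xor_bias A u v).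
Proof.
split=> [u v|].
  exact: (le_bigmax _ (fun s => xor_bias A s.1 s.2) (u, v)).
rewrite /classical_value.
elim/big_ind: _ => [|x y [u [v ->]] [u' [v' ->]]|[u v] _]; last 1 first.
- by exists u, v.
- by exists [ffun=> false], [ffun=> false].
- by case: leP => _; [exists u', v'|exists u, v].
Qed.

(* The preimages are taken in T, so for J empty both sides are 1. *)
Definition mutually_independent (d : measure_display) (T : measurableType d)
    (R : realType) (P : probability T R) (I : finType)
    (X : I -> {RV P >-> R}) : Prop :=
  forall (J : {set I}) (B : I -> set R),
    (forall i, i \in J -> measurable (B i)) ->
    P (\bigcap_(i in [set` J]) (X i @^-1` B i)) =
    (\prod_(i in J) P (X i @^-1` B i))%E.

Definition uniform_sign (d : measure_display) (T : measurableType d)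
    (R : realType) (P : probability T R) (X : {RV P >-> R}) : Prop :=
  P [set w | X w = 1] = (2^-1)%:E /\ P [set w | X w = -1] = (2^-1)%:E.

Definition random_sign_matrix (d : measure_display) (T : measurableType d)
    (R : realType) (P : probability T R) (n : nat)
    (A : 'I_n -> 'I_n -> {RV P >-> R}) : Prop :=
  mutually_independent (fun ij : 'I_n * 'I_n => A ij.1 ij.2) /\
  (forall i j, uniform_sign (A i j)).

Definition lower_const (R : realType) : R :=
  (2 + 2 * expR (- pi^-1) + (2 + pi) * Erf (1 / Num.sqrt pi)) /
  (2 * Num.sqrt (2 * pi)).

(* Main.v *)
Require Import Defs.
From HB Require Import structures.
From mathcomp Require Import all_boot all_order all_algebra.
From mathcomp Require Import all_classical all_reals all_analysis.
From mathcomp Require Import measurable_realfun.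
From mathcomp Require Import zify ring lra.

(* Lower bound: process the rows one at a time, keeping the vector S of signed
   column sums, and give each new row the sign that correlates positively with
   the signs of S.  Every |S_j| is then a reflected walk whose upward bias is
   p = C(2m, m) / 4 ^ m ~ sqrt (2 / (pi n)) with m = n / 2, and the players
   reach the sum of the |S_j|.  The method of images gives the expectation of
   the reflected walk in closed form; it contains the mean sign of the biased
   walk, a polynomial D in p with D' = (2m + 1) C(2m, m) / 4 ^ m (1 - p ^ 2) ^ m
   and D(1) = 1.  Comparing D' with a Gaussian gives both the asymptotics of
   the central binomial coefficient and the error function in the constant.
   Flipping one entry of the matrix moves the maximum by at most 2, so its
   variance is at most n ^ 2 (Efron-Stein) and it concentrates at the scale
   n ^ (3/2).  Upper bound: exponential moments and a union bound over the
   4 ^ n pairs of answers. *)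

Set Implicit Arguments.
Unset Strict Implicit.
Unset Printing Implicit Defensive.

Import Order.TTheory GRing.Theory Num.Theory.
Import numFieldNormedType.Exports.

Local Open Scope classical_set_scope.
Local Open Scope ring_scope.

(** * Uniform sign sequences and biased walks *)

(** Expectation over [k] independent fair bits, encoded by conditioning on the first bit, so that
    inductions peel off single entries or whole rows of the matrix. *)
Fixpoint avg (R : realType) (k : nat) (g : seq bool -> R) : R :=
  if k is k'.+1 then
    (avg k' (fun s => g (false :: s)) + avg k' (fun s => g (true :: s))) / 2
  else g [::].

Lemma le_avg (R : realType) k (g h : seq bool -> R) :
  (forall s, size s = k -> g s <= h s) -> avg k g <= avg k h.
Proof.
elim: k g h => [|k IH] g h gh /=; first exact: gh.
by rewrite ler_pM2r ?invr_gt0// lerD// IH// => s sk; apply: gh; rewrite /= sk.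
Qed.

Lemma eq_avg (R : realType) k (g h : seq bool -> R) :
  (forall s, size s = k -> g s = h s) -> avg k g = avg k h.
Proof. by move=> gh; apply/eqP; rewrite eq_le !le_avg// => s /gh ->. Qed.

Lemma avgD (R : realType) k (g h : seq bool -> R) :
  avg k (fun s => g s + h s) = avg k g + avg k h.
Proof. by elim: k g h => [//|k IH] g h /=; rewrite !IH; field. Qed.

Lemma avgZ (R : realType) k c (g : seq bool -> R) :
  avg k (fun s => c * g s) = c * avg k g.
Proof. by elim: k g => [//|k IH] g /=; rewrite !IH; field. Qed.

Lemma avg_cst (R : realType) k (c : R) : avg k (fun=> c) = c.
Proof. by elim: k => [//|k IH] /=; rewrite IH; field. Qed.

Lemma avg_sum (R : realType) k (I : finType) (g : I -> seq bool -> R) :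
  avg k (fun s => \sum_i g i s) = \sum_i avg k (g i).
Proof.
elim: k g => [//|k IH] g /=.
by rewrite !IH -big_split/= mulr_suml.
Qed.

Lemma avg_cat (R : realType) k l (g : seq bool -> R) :
  avg (k + l) g = avg k (fun s => avg l (fun t => g (s ++ t))).
Proof. by elim: k g => [//|k IH] g; rewrite addSn /= !IH. Qed.

Definition xors (m s : seq bool) : seq bool := [seq x.1 (+) x.2 | x <- zip m s].

(** Xoring with a fixed mask permutes the equally likely bit strings; [greedy_row] uses this to
    treat all column sums as if they were nonnegative. *)
Lemma avg_xors (R : realType) (m : seq bool) (g : seq bool -> R) :
  avg (size m) (fun s => g (xors m s)) = avg (size m) g.
Proof.
elim: m g => [//|[] m IH] g /=; last first.
  by rewrite (IH (fun s => g (false :: s))) (IH (fun s => g (true :: s))).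
rewrite (IH (fun s => g (false :: s))) (IH (fun s => g (true :: s))).
by rewrite addrC.
Qed.

Definition sgz_of (b : bool) : int := (-1) ^+ b.
Definition bitsum (s : seq bool) : int := \sum_(b <- s) sgz_of b.

Fixpoint walk (R : realType) (a b : R) (k : nat) (g : int -> R) (x : int) : R :=
  if k is k'.+1 then a * walk a b k' g (x + 1) + b * walk a b k' g (x - 1)
  else g x.

Lemma avg_bitsum (R : realType) k (g : int -> R) x :
  avg k (fun s => g (x + bitsum s)) = walk (2^-1) (2^-1) k g x.
Proof.
elim: k x => [|k IH] x /=; first by rewrite /bitsum big_nil addr0.
rewrite -!IH mulrDl ![_^-1 * _]mulrC.
by congr (_ * _ + _ * _); apply: eq_avg => s _;
   rewrite /bitsum big_cons addrA.
Qed.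

Lemma walkE (R : realType) (a b : R) k (g : int -> R) x :
  walk a b k g x =
  \sum_(i < k.+1) 'C(k, i)%:R * a ^+ (k - i) * b ^+ i * g (x + k%:Z - (2 * i)%:Z).
Proof.
elim: k x => [|k IH] x.
  by rewrite big_ord1 /= bin0 expr0 !mul1r addr0 subr0.
rewrite /= !IH big_ord_recl big_ord_recr/=.
rewrite [in RHS]big_ord_recl [in RHS]big_ord_recr /=.
rewrite !bin0 !binn !subnn !subn0 !expr0 !mul1r !mulr1.
rewrite mulrDr [in X in _ + X]mulrDr.
set S1 := \sum_(i < k) _; set S2 := \sum_(i < k) _; set S3 := \sum_(i < k) _.
have -> : S3 = a * S1 + b * S2.
  rewrite /S1 /S2 /S3 !mulr_sumr -big_split; apply: eq_bigr => -[i ik] _ /=.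
  rewrite /bump /= !add1n binS natrD.
  have -> : (k.+1 - i.+1 = k - i)%N by lia.
  have -> : (k - i = (k - i.+1).+1)%N by lia.
  have -> : x + 1 + k%:Z - (2 * i.+1)%:Z = x + k.+1%:Z - (2 * i.+1)%:Z by lia.
  have -> : x - 1 + k%:Z - (2 * i)%:Z = x + k.+1%:Z - (2 * i.+1)%:Z by lia.
  rewrite !exprS; ring.
have -> : x + 1 + k%:Z - (2 * 0)%:Z = x + k.+1%:Z - (2 * 0)%:Z by lia.
have -> : x - 1 + k%:Z - (2 * k)%:Z = x + k.+1%:Z - (2 * k.+1)%:Z by lia.
rewrite !exprS; ring.
Qed.

(** The probability that the symmetric walk is back at its origin after [2 * m] steps. *)
Definition wallis (R : realType) (m : nat) : R := 'C(2 * m, m)%:R / 4 ^+ m.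

Lemma walk_even0 (R : realType) (a b : R) m :
  walk a b (2 * m) (fun x => (x == 0)%:R) 0 = wallis R m * (4 * a * b) ^+ m.
Proof.
rewrite walkE (bigD1 (inord m)) //= inordK; last lia.
rewrite big1 => [|[i ik] /= /eqP im].
  rewrite (_ : (0 + _ - _ == 0) = true); last by apply/eqP; lia.
  have -> : (2 * m - m = m)%N by lia.
  rewrite /wallis !exprMn mulr1 addr0.
  by field; rewrite expf_neq0.
rewrite (_ : (0 + _ - _ == 0) = false) ?mulr0//.
apply/eqP => h; apply: im; apply: val_inj; rewrite /= inordK; lia.
Qed.

(** Pascal's rule splits the central coefficient into two binomials that are equal by symmetry. *)
Lemma wallisS_half (R : realType) m :
  'C((2 * m).+1, m)%:R / 4 ^+ m.+1 = wallis R m.+1 / 2 :> R.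
Proof.
rewrite /wallis (_ : (2 * m.+1 = (2 * m).+2)%N); last lia.
rewrite binS natrD -(@bin_sub (2 * m).+1 m.+1); last lia.
rewrite (_ : ((2 * m).+1 - m.+1 = m)%N); last lia.
by rewrite exprS; field; rewrite expf_neq0.
Qed.

(** Reaching 1 takes one more up step than down steps, with weight [a ^+ m.+1 * b ^+ m]; the extra
    factor [b] completes this to a power of [a * b]. *)
Lemma walk_odd1 (R : realType) (a b : R) m :
  b * walk a b (2 * m).+1 (fun x => (x == 1)%:R) 0 =
  wallis R m.+1 / 2 * (4 * a * b) ^+ m.+1.
Proof.
rewrite walkE (bigD1 (inord m)) //= inordK; last lia.
rewrite big1 => [|[i ik] /= /eqP im].
  rewrite (_ : (0 + _ - _ == 1) = true); last by apply/eqP; lia.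
  have -> : ((2 * m).+1 - m = m.+1)%N by lia.
  rewrite -wallisS_half !exprMn mulr1 addr0 [b ^+ m.+1]exprS.
  by field; rewrite expf_neq0.
rewrite (_ : (0 + _ - _ == 1) = false) ?mulr0//.
apply/eqP => h; apply: im; apply: val_inj; rewrite /= inordK; lia.
Qed.

Lemma walk_oddN1 (R : realType) (a b : R) m :
  a * walk a b (2 * m).+1 (fun x => (x == -1)%:R) 0 =
  wallis R m.+1 / 2 * (4 * a * b) ^+ m.+1.
Proof.
rewrite walkE (bigD1 (inord m.+1)) //= inordK; last lia.
rewrite big1 => [|[i ik] /= /eqP im].
  rewrite (_ : (0 + _ - _ == -1) = true); last by apply/eqP; lia.
  have -> : ((2 * m).+1 - m.+1 = m)%N by lia.
  rewrite -wallisS_half !exprMn mulr1 addr0 -bin_sub; last lia.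
  have -> : ((2 * m).+1 - m.+1 = m)%N by lia.
  rewrite [a ^+ m.+1]exprS.
  by field; rewrite expf_neq0.
rewrite (_ : (0 + _ - _ == -1) = false) ?mulr0//.
apply/eqP => h; apply: im; apply: val_inj; rewrite /= inordK; lia.
Qed.

Lemma walk_parity (R : realType) (a b : R) k (y : int) :
  odd k != odd `|y| -> walk a b k (fun x => (x == y)%:R) 0 = 0.
Proof.
move=> h; rewrite walkE big1// => -[i ik] _ /=.
rewrite (_ : (0 + _ - _ == y) = false) ?mulr0//.
by apply/eqP => hy; move: h; lia.
Qed.

Lemma walkD (R : realType) (a b : R) k (g h : int -> R) x :
  walk a b k (fun x => g x + h x) x = walk a b k g x + walk a b k h x.
Proof. by elim: k x => [//|k IH] x /=; rewrite !IH; ring. Qed.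

Lemma walkZ (R : realType) (a b : R) k c (g : int -> R) x :
  walk a b k (fun x => c * g x) x = c * walk a b k g x.
Proof. by elim: k x => [//|k IH] x /=; rewrite !IH; ring. Qed.

Lemma eq_walk (R : realType) (a b : R) k (g h : int -> R) x :
  g =1 h -> walk a b k g x = walk a b k h x.
Proof. by move=> gh; elim: k x => [|k IH] x /=; rewrite ?gh ?IH. Qed.

Lemma walkSr (R : realType) (a b : R) k (g : int -> R) x :
  walk a b k.+1 g x = walk a b k (fun y => a * g (y + 1) + b * g (y - 1)) x.
Proof.
elim: k x => [//|k IH] x.
rewrite (_ : walk a b k.+2 g x =
  a * walk a b k.+1 g (x + 1) + b * walk a b k.+1 g (x - 1)); last by [].
by rewrite !IH.
Qed.

(* The bias that one greedy row gives to each column. *)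
Lemma walk_majority (R : realType) n :
  walk (2^-1) (2^-1) n (fun x => (x == 0)%:R + (x == -1)%:R) 0 = wallis R n.+1./2.
Proof.
rewrite walkD.
have h4 : 4 * 2^-1 * 2^-1 = 1 :> R by field.
have [nodd|neven] := boolP (odd n).
  have [m ->] : exists m, n = (2 * m).+1 by exists n./2; lia.
  rewrite walk_parity; last by rewrite /=; lia.
  have := walk_oddN1 (2^-1 : R) 2^-1 m; rewrite h4 expr1n => e.
  rewrite (_ : (_./2 = m.+1)%N); last by lia.
  by lra.
have [m ->] : exists m, n = (2 * m)%N by exists n./2; lia.
rewrite walk_even0 walk_parity; last by rewrite /=; lia.
by rewrite h4 expr1n mulr1 addr0; congr (wallis _ _); lia.
Qed.

(** * The reflected walk *)

Lemma wallisS (R : realType) m :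
  (2 * m + 2)%:R * wallis R m.+1 = (2 * m + 1)%:R * wallis R m.
Proof.
have h1 : ((2 * m).+2 * 'C((2 * m).+1, m) = m.+1 * 'C((2 * m).+2, m.+1))%N.
  exact: mul_bin_diag.
have h2 : ((2 * m).+1 * 'C(2 * m, m) = m.+1 * 'C((2 * m).+1, m))%N.
  by rewrite (mul_bin_down (2 * m).+1 m); congr (_ * _)%N; lia.
rewrite /wallis (_ : (2 * m.+1 = (2 * m).+2)%N); last lia.
have h : ((2 * m + 2) * 'C((2 * m).+2, m.+1) = 4 * (2 * m + 1) * 'C(2 * m, m))%N.
  by nia.
have h' : (2 * m + 2)%:R * 'C((2 * m).+2, m.+1)%:R =
    4 * (2 * m + 1)%:R * 'C(2 * m, m)%:R :> R by rewrite -!natrM h.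
by rewrite mulrA h' exprS; field; rewrite expf_neq0.
Qed.

Lemma wallis0 (R : realType) : wallis R 0 = 1.
Proof. by rewrite /wallis bin0 expr0 divr1. Qed.

Lemma wallis_gt0 (R : realType) m : 0 < wallis R m.
Proof. by rewrite divr_gt0// ?exprn_gt0// ltr0n bin_gt0; lia. Qed.

Lemma wallis_le1 (R : realType) m : wallis R m <= 1.
Proof.
elim: m => [|m IH]; first by rewrite wallis0.
have := wallisS R m; have := wallis_gt0 R m.+1; have := wallis_gt0 R m.
rewrite !natrD => ? ? ?; have : (0:R) <= (2 * m)%:R by [].
nra.
Qed.

(* The walk on the nonnegative integers that stays at 0 instead of stepping
   down; [walk] started at 0 has the law of its reflection. *)
Fixpoint lindley (R : realType) (a b : R) (k z : nat) : R :=
  if k is k'.+1 then a * lindley a b k' z.+1 + b * lindley a b k' z.-1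
  else z%:R.

Lemma le_lindley (R : realType) (a b : R) k z :
  0 <= a -> 0 <= b -> lindley a b k z <= lindley a b k z.+1.
Proof.
move=> a0 b0; elim: k z => [|k IH] z /=; first by rewrite ler_nat.
rewrite lerD// ler_wpM2l//.
by case: z => [//|z] /=; exact: IH.
Qed.

(** The first step from 0 leads to 1 or stays at 0, and [lindley] is nondecreasing in its starting
    point. This reduces even horizons to odd ones. *)
Lemma lindleyS_ge (R : realType) (a b : R) k :
  0 <= a -> 0 <= b -> a + b = 1 -> lindley a b k 0 <= lindley a b k.+1 0.
Proof.
move=> a0 b0 ab /=; have := @le_lindley R a b k 0 a0 b0.
by rewrite (_ : b = 1 - a); [nra|lra].
Qed.

(** The extension of the identity to negative integers that is forced by [antisym_diff] below; in
    particular its values at 0 and -1 agree. *)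
Definition reflect_ext (R : realType) (r : R) (x : int) : R :=
  match x with Posz z => z%:R | Negz i => \sum_(l < i) r ^+ l.+1 end.

(* The image-charge condition that makes [walk] satisfy the boundary
   condition of [lindley]. *)
Definition antisym_diff (R : realType) (r : R) (g : int -> R) :=
  forall x : nat, g (- x%:Z) - g (- x%:Z - 1) =
                  - r ^+ x * (g x%:Z - g (x%:Z - 1)).

(** Put [d x = g x - g (x - 1)]; the condition reads [d (- x) = - r ^+ x * d x]. A step replaces
    [d x] by [a * d (x + 1) + b * d (x - 1)], and [a = r * b] makes the two terms at [- x] match the
    two terms at [x] in the opposite order. *)
Lemma antisym_diff_walk (R : realType) (r a b : R) k (g : int -> R) :
  a = r * b -> antisym_diff r g -> antisym_diff r (walk a b k g).
Proof.
move=> ab; elim: k => [//|k IH] /IH {IH} h x /=; move: h.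
move: (walk a b k g) => f h.
case: x => [|x].
  have h1 : f (-1) - f (-2) = - r * (f 1 - f 0) by rewrite -[r]expr1 (h 1%N).
  change (a * f 1 + b * f (-1) - (a * f 0 + b * f (-2)) =
    - 1 * (a * f 1 + b * f (-1) - (a * f 0 + b * f (-2)))).
  by have := congr1 (fun y => b * y) h1; rewrite ab; lra.
have := h x.+2.
have := h x.
have -> : - x.+1%:Z + 1 = - x%:Z by lia.
have -> : - x.+1%:Z - 1 + 1 = - x%:Z - 1 by lia.
have -> : - x.+2%:Z = - x.+1%:Z - 1 by lia.
have -> : x.+2%:Z - 1 = x.+1%:Z by lia.
have -> : x.+1%:Z - 1 + 1 = x.+1%:Z by lia.
have -> : x.+1%:Z - 1 = x%:Z by lia.
have -> : x.+1%:Z + 1 = x.+2%:Z by lia.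
rewrite !exprS ab => h1 h2.
have := congr1 (fun y => r * b * y) h1.
have := congr1 (fun y => b * y) h2.
by lra.
Qed.

Lemma reflect_ext_antisym (R : realType) (r : R) : antisym_diff r (reflect_ext r).
Proof.
move=> [|x].
  have -> : - 0%:Z = 0 by [].
  have -> : 0 - 1 = Negz 0 by [].
  rewrite /= big_ord0; ring.
have -> : - x.+1%:Z = Negz x by lia.
have -> : Negz x - 1 = Negz x.+1 by lia.
have -> : x.+1%:Z - 1 = x%:Z by lia.
rewrite /reflect_ext big_ord_recr/= -[in X in - _ * X]natr1; ring.
Qed.

Lemma lindley_walk (R : realType) (r a b : R) k (z : nat) :
  a = r * b -> lindley a b k z = walk a b k (reflect_ext r) z%:Z.
Proof.
move=> ab; elim: k z => [//|k IH] z /=; rewrite !IH.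
have -> : z%:Z + 1 = z.+1%:Z by lia.
case: z => [|z] /=; last by have -> : z.+1%:Z - 1 = z%:Z by lia.
(* At distance 0 the image condition says that the values at 0 and -1 coincide, so stepping down to
   -1 amounts to staying at 0. *)
have := antisym_diff_walk k ab (@reflect_ext_antisym R r) 0%N.
by rewrite expr0 oppr0 !sub0r => h; congr (_ + _ * _); lra.
Qed.

Lemma positive_step (R : realType) (a b : R) (x : int) : a + b = 1 ->
  a * (0 < x + 1)%R%:R + b * (0 < x - 1)%R%:R =
  (0 < x)%R%:R + a * (x == 0)%:R + - b * (x == 1)%:R.
Proof.
move=> ab; case: x => [[|[|x]]|[|i]].
- by rewrite /=; lra.
- by rewrite /=; lra.
- have -> : x.+2%:Z - 1 = x.+1%:Z by lia.
  by rewrite /=; lra.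
- by rewrite /=; lra.
have -> : Negz i.+1 + 1 = Negz i by lia.
by rewrite /=; lra.
Qed.

(** On the positive side a step adds the drift [a - b], and left of -1 the geometric sums are
    harmonic for the walk; only the defects at 0 and -1 remain. *)
Lemma reflect_ext_step (R : realType) (r a b : R) (x : int) :
  a = r * b -> a + b = 1 ->
  a * reflect_ext r (x + 1) + b * reflect_ext r (x - 1) =
  reflect_ext r x + (a - b) * (0 < x)%R%:R + a * (x == 0)%:R + a * (x == -1)%:R.
Proof.
move=> arb ab; case: x => [[|[|x]]|[|i]].
- by rewrite /= big_ord0; lra.
- by rewrite (_ : 1%:Z + 1 = 2%:Z) // (_ : 1%:Z - 1 = 0%:Z) // /=; lra.
- have -> : x.+2%:Z + 1 = x.+3%:Z by lia.
  have -> : x.+2%:Z - 1 = x.+1%:Z by lia.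
  rewrite /= -!natr1; set y := x%:R; have -> : b = 1 - a by lra.
  by ring.
- have -> : Negz 0 + 1 = 0 by [].
  have -> : Negz 0 - 1 = Negz 1 by [].
  by rewrite /= big_ord0 big_ord1 expr1 arb; ring.
have -> : Negz i.+1 + 1 = Negz i by lia.
have -> : Negz i.+1 - 1 = Negz i.+2 by lia.
have -> : (Negz i.+1 == -1) = false by lia.
rewrite /= !big_ord_recr /= [in X in _ + _ + X]exprS.
set S := \sum_(l < i) _; set t := r ^+ _.
rewrite (_ : b * (S + t + r * t) = b * S + b * t + (r * b) * t); last by ring.
rewrite -arb (_ : b = 1 - a); last by lra.
by ring.
Qed.

(** * Closed form for the expectation of the reflected walk *)

Section closed_form.
Variables (R : realType) (p a b : R).
Hypotheses (p0 : p != 0) (p1 : p < 1).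
Hypotheses (aE : a = (1 + p) / 2) (bE : b = (1 - p) / 2).

Local Notation q := (1 - p ^+ 2).
Local Notation point k y := (walk a b k (fun x => (x == y)%:R) 0).
Local Notation tail k := (walk a b k (fun x => (0 < x)%R%:R) 0).
Local Notation refl k := (walk a b k (reflect_ext (a / b)) 0).

Let ab : 4 * a * b = q. Proof. by rewrite aE bE; field. Qed.
Let ab1 : a + b = 1. Proof. by rewrite aE bE; field. Qed.

Let tailS k : tail k.+1 = tail k + a * point k 0 - b * point k 1.
Proof.
rewrite walkSr -mulNr -2!walkZ -2!walkD; apply: eq_walk => x.
exact: positive_step.
Qed.

Let reflS k : refl k.+1 = refl k + p * tail k + a * (point k 0 + point k (-1)).
Proof.
have b0 : b != 0 by rewrite bE mulf_neq0 ?invr_eq0 ?pnatr_eq0// subr_eq0 gt_eqF.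
rewrite walkSr mulrDr addrA -3!walkZ -3!walkD; apply: eq_walk => x.
rewrite reflect_ext_step ?divfK// (_ : a - b = p)//; by rewrite aE bE; field.
Qed.

(** The polynomial D. By [tail_odd] below it is the mean sign of the walk with bias [p] at time
    [2 * m + 1], when the walk cannot be at 0. *)
Definition mean_sign m := p * \sum_(i < m.+1) wallis R i * q ^+ i.

Let mean_signS m : mean_sign m.+1 = mean_sign m + p * wallis R m.+1 * q ^+ m.+1.
Proof. by rewrite /mean_sign big_ord_recr /=; ring. Qed.

(** Two applications of [tailS]: by parity only the point 0 contributes at the even time and only
    the point 1 at the odd time. *)
Let tail_even m : tail (2 * m) = (1 + mean_sign m - wallis R m * q ^+ m * (1 + p)) / 2.
Proof.
elim: m => [|m IH].
  by rewrite /= /mean_sign big_ord1 wallis0 expr0; lra.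
rewrite (_ : (2 * m.+1 = (2 * m).+2)%N); last by rewrite mulnS.
rewrite !tailS IH walk_even0 (@walk_parity _ _ _ (2 * m) 1); last by rewrite ?oddS oddM.
rewrite walk_odd1 walk_parity; last by rewrite ?oddS oddM.
by rewrite ab mean_signS aE; lra.
Qed.

Let tail_odd m : tail (2 * m).+1 = (1 + mean_sign m) / 2.
Proof.
rewrite tailS tail_even walk_even0 walk_parity; last by rewrite ?oddS oddM.
by rewrite ab aE; lra.
Qed.

(** Accumulates the increments [reflS] two steps at a time; by parity one point probability survives
    in each, and the recurrence [wallisS] closes the induction. *)
Lemma lindley_odd m :
  lindley a b (2 * m).+1 0 =
  ((2 * m + 1)%:R * p + (2 * m + 1)%:R * wallis R m * (1 - p ^+ 2) ^+ m.+1 +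
   ((2 * m + 1)%:R * p + p^-1) * mean_sign m - 1) / 2.
Proof.
have b0 : b != 0 by rewrite bE mulf_neq0 ?invr_eq0 ?pnatr_eq0// subr_eq0 gt_eqF.
rewrite (@lindley_walk R (a / b)) ?divfK//.
elim: m => [|m IH].
  rewrite reflS /= /mean_sign big_ord1 wallis0 !expr0 expr1 aE.
  by field.
rewrite (_ : (2 * m.+1 = (2 * m).+2)%N); last by rewrite mulnS.
rewrite (reflS (2 * m).+2) (reflS (2 * m).+1) IH tail_odd.
rewrite (_ : ((2 * m).+2 = 2 * m.+1)%N); last by rewrite mulnS.
rewrite tail_even walk_even0.
rewrite (@walk_parity _ _ _ (2 * m).+1 0); last by rewrite ?oddS oddM.
rewrite (@walk_parity _ _ _ (2 * m.+1) (-1)); last by rewrite oddM.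
rewrite [a * (0 + _)]mulrDr walk_oddN1 ab mean_signS.
have := wallisS R m; rewrite [q ^+ m.+2]exprS.
rewrite (_ : (2 * m.+1 + 1)%:R = (2 * m + 1)%:R + 2 :> R); last first.
  by rewrite mulnS -addnA addnC natrD.
rewrite (_ : (2 * m + 2)%:R = (2 * m + 1)%:R + 1 :> R); last first.
  by rewrite -[2%N]/(1 + 1)%N addnA natrD.
move: (wallis R m) (wallis R m.+1) (q ^+ m.+1) (mean_sign m) ((2 * m + 1)%:R : R).
move=> w w' Q D N e.
rewrite -e aE {e}; field.
exact: p0.
Qed.

End closed_form.

(** * The greedy answers *)

Lemma bitsum_cons b s : bitsum (b :: s) = sgz_of b + bitsum s.
Proof. by rewrite /bitsum big_cons. Qed.

Lemma bitsum_cat s t : bitsum (s ++ t) = bitsum s + bitsum t.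
Proof. by rewrite /bitsum big_cat. Qed.

(** A bit is pivotal for the majority when the remaining votes sum to 0 or to -1; the value -1
    counts because a tie is decided in favour of plus. *)
Lemma majority_step (R : realType) (z : int) :
  ((-1) ^+ (z + 1 < 0)%R - (-1) ^+ (z - 1 < 0)%R) / 2 =
  (z == 0)%:R + (z == -1)%:R :> R.
Proof.
case: z => [[|z]|[|z]].
- by rewrite /= expr0 expr1; lra.
- have -> : (z.+1%:Z + 1 < 0)%R = false by lia.
  have -> : (z.+1%:Z - 1 < 0)%R = false by lia.
  by rewrite /=; lra.
- by rewrite /= expr0 expr1; lra.
have -> : (Negz z.+1 + 1 < 0)%R = true by lia.
have -> : (Negz z.+1 - 1 < 0)%R = true by lia.
have -> : (Negz z.+1 == -1) = false by lia.
by rewrite /=; lra.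
Qed.

(** Conditioning on bit [j], the correlation of the majority with that bit is the probability that
    the bit is pivotal among the other [n - 1], given by [walk_majority]. *)
Lemma avg_majority (R : realType) n (j : nat) : (j < n)%N ->
  avg n (fun y => (-1) ^+ (bitsum y < 0)%R * (-1) ^+ nth false y j) =
  wallis R n./2.
Proof.
move=> jn; have [l ->] : exists l, n = (j + l.+1)%N by exists (n - j.+1)%N; lia.
rewrite avg_cat addnS -walk_majority -avg_bitsum avg_cat.
apply: eq_avg => s sj /=; rewrite mulrDl -2!(mulrC 2^-1) -2!avgZ -avgD.
apply: eq_avg => t _; rewrite !nth_cat !sj ltnn subnn /= !bitsum_cat !bitsum_cons.
rewrite /sgz_of !add0r expr0 expr1 mulr1 mulrN1 mulrC -majority_step.
rewrite (addrCA _ 1) (addrCA _ (-1)) (addrC 1) (addrC (-1)).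
by field.
Qed.

(** For nonzero [z] this is an equality: the modulus grows exactly when the step agrees with the
    sign of [z]. At 0 both steps lead to modulus 1, and monotonicity gives the inequality. *)
Lemma step_away (R : realType) (f : nat -> R) (z : int) (c : bool) :
  (forall z, f z <= f z.+1) ->
  (f `|z|%N.+1 + f `|z|%N.-1) / 2 +
  (f `|z|%N.+1 - f `|z|%N.-1) / 2 * (-1) ^+ (c (+) (z < 0)%R) <= f (absz (z + sgz_of c)).
Proof.
move=> fS; rewrite /sgz_of.
case: z => [[|z]|z]; case: c; rewrite /= ?expr0 ?expr1.
- by have := fS 0%N; lra.
- by have := fS 0%N; lra.
- by rewrite subn1; lra.
- by rewrite addn1; lra.
- by rewrite addn0; lra.
rewrite (_ : absz (Negz z + 1) = z); last by lia.
by lra.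
Qed.

Lemma greedy_row (R : realType) n (S : 'I_n -> int) (f : nat -> R) :
  (forall z, f z <= f z.+1) ->
  let p := wallis R n./2 in
  exists u : seq bool -> bool,
  \sum_j ((1 + p) / 2 * f `|S j|%N.+1 + (1 - p) / 2 * f `|S j|%N.-1) <=
  avg n (fun y => \sum_j f (absz (S j + sgz_of (u y (+) nth false y j)))).
Proof.
move=> fmono p; pose sigma := [seq (S j < 0)%R | j <- enum 'I_n].
have ssigma : size sigma = n by rewrite size_map size_enum_ord.
(* The greedy sign: that of the correlation between the row [y] and the signs of [S]. *)
pose u y := (bitsum (xors sigma y) < 0)%R.
exists u; rewrite avg_sum; apply: ler_sum => j _.
have sigmaj : nth false sigma j = (S j < 0)%R.
  by rewrite (nth_map j) ?size_enum_ord// nth_ord_enum.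
have <- : avg n (fun y => (-1) ^+ u y * (-1) ^+ (nth false y j (+) (S j < 0)%R)) = p.
  rewrite /p -(@avg_majority R n j)//; have := avg_xors sigma
    (fun y => (-1) ^+ (bitsum y < 0)%R * (-1) ^+ nth false y j : R).
  rewrite ssigma => <-; apply: eq_avg => y sy; congr (_ * _ ^+ _).
  rewrite /xors (nth_map (false, false)) ?size_zip ?ssigma ?sy ?minnn//.
  by rewrite nth_zip ?ssigma ?sy//= sigmaj addbC.
set f1 := f _.+1; set f2 := f _.-1.
rewrite (_ : _ + _ = (f1 + f2) / 2 + (f1 - f2) / 2 *
    avg n (fun y => (-1) ^+ u y * (-1) ^+ (nth false y j (+) (S j < 0)%R))); last by field.
rewrite -avgZ -{1}(avg_cst n ((f1 + f2) / 2)) -avgD.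
apply: le_avg => y _; rewrite -signr_addb addbA; exact: step_away.
Qed.

(** Induction on the number of rows, with [greedy_row] applied to the value function [lindley].
    Since [H] dominates the outcome of every choice of [u], the row signs may depend on the matrix;
    arbitrary initial sums [S] carry the state from row to row. *)
Lemma greedy (R : realType) n k (S : 'I_n -> int) (H : seq bool -> R) :
  let p := wallis R n./2 in
  (forall s (u : nat -> bool), size s = (k * n)%N ->
    \sum_j (absz (S j + \sum_(i < k) sgz_of (u i (+) nth false s (i * n + j))))%:R
      <= H s) ->
  \sum_j lindley ((1 + p) / 2) ((1 - p) / 2) k `|S j|%N <= avg (k * n) H.
Proof.
move=> p; elim: k S H => [|k IH] S H hH.
  have := hH [::] xpredT erefl; rewrite /=.
  by under eq_bigr do rewrite big_ord0 addr0.
rewrite mulSn avg_cat /=.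
have p0 : 0 < p := wallis_gt0 _ _.
have p1 : p <= 1 := wallis_le1 _ _.
have a0 : 0 <= (1 + p) / 2 by lra.
have b0 : 0 <= (1 - p) / 2 by lra.
have [u] := @greedy_row R n S _ (fun z => le_lindley k z a0 b0).
move=> /le_trans -> //; apply: le_avg => y sy.
apply: (IH (fun j => S j + sgz_of (u y (+) nth false y j))) => s v ss.
have := hH (y ++ s) (fun i => if i is i'.+1 then v i' else u y).
rewrite size_cat sy ss -mulSn => /(_ erefl); apply: le_trans.
rewrite le_eqVlt; apply/orP; left; apply/eqP; apply: eq_bigr => j _.
rewrite big_ord_recl /= mul0n add0n nth_cat sy ltn_ord -addrA.
congr ((absz (_ + (_ + _)))%:R); apply: eq_bigr => i _.
rewrite nth_cat sy /bump/= add1n mulSn -addnA ltnNge leq_addr /=.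
by rewrite addKn.
Qed.

Definition sign_mx (R : realType) n (s : seq bool) : 'M[R]_n :=
  \matrix_(i < n, j < n) (-1) ^+ nth false s (i * n + j).

Definition max_bias (R : realType) n (s : seq bool) : R :=
  n%:R ^+ 2 * classical_value (sign_mx R n s).

Lemma max_bias_ge (R : realType) n (s : seq bool) (u v : {ffun 'I_n -> bool}) :
  \sum_(i < n) \sum_(j < n) (-1) ^+ nth false s (i * n + j) * (-1) ^+ u i * (-1) ^+ v j
    <= max_bias R n s.
Proof.
case: n u v => [|n] u v.
  by rewrite /max_bias big_ord0 expr0n mul0r.
have [h _] := classical_value_max (sign_mx R n.+1 s).
rewrite -ler_pdivrMl ?exprn_gt0 ?ltr0n//; apply: le_trans (h u v).
rewrite /xor_bias le_eqVlt; apply/orP; left; apply/eqP; congr (_ * _).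
by apply: eq_bigr => i _; apply: eq_bigr => j _; rewrite mxE.
Qed.

Lemma avg_max_bias (R : realType) n :
  n%:R * lindley ((1 + wallis R n./2) / 2) ((1 - wallis R n./2) / 2) n 0
    <= avg (n * n) (max_bias R n).
Proof.
have := @greedy R n n (fun=> 0) (max_bias R n).
rewrite /= sumr_const card_ord [X in _ -> X <= _]mulr_natl => h; apply: h => s u ss.
pose c j : int := \sum_(i < n) sgz_of (u i (+) nth false s (i * n + j)).
(* The second player answers with the signs of the final column sums [c j], which turns the bias
   into the sum of their absolute values. *)
apply: le_trans (max_bias_ge R s [ffun i : 'I_n => u i] [ffun j : 'I_n => (c j < 0)%R]).
rewrite exchange_big /= ler_sum// => j _.
rewrite ffunE add0r -/(c j) -mulr_suml.
have -> : \sum_(i < n) (-1) ^+ nth false s (i * n + j) * (-1) ^+ [ffun i : 'I_n => u i] i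
    = (c j)%:~R :> R.
  rewrite /c rmorph_sum; apply: eq_bigr => i _.
  by rewrite ffunE /sgz_of rmorphXn rmorphN rmorph1 -signr_addb addbC.
by case: (c j) => z /=; rewrite ?expr0 ?expr1 ?mulr1 ?mulrN1 ?NegzE ?mulrNz ?opprK.
Qed.

(** * Concentration and upper tail *)

(** Efron-Stein by induction: the variance is the mean of the two conditional variances plus a
    quarter of the squared difference of the conditional means. That difference is at most 2, so
    each bit contributes at most 1. *)
Lemma avg_var (R : realType) k (g : seq bool -> R) :
  (forall s1 b b' s2, size (s1 ++ b :: s2) = k ->
    g (s1 ++ b :: s2) <= g (s1 ++ b' :: s2) + 2) ->
  avg k (fun s => g s ^+ 2) <= avg k g ^+ 2 + k%:R.
Proof.
elim: k g => [|k IH] g hg /=; first by rewrite addr0.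
have IHb b : avg k (fun s => g (b :: s) ^+ 2) <= avg k (fun s => g (b :: s)) ^+ 2 + k%:R.
  by apply: (IH (fun s => g (b :: s))) => s1 c c' s2 ss; apply: (hg (b :: s1)); rewrite /= ss.
have := IHb false; have := IHb true.
have diff b b' : avg k (fun s => g (b :: s)) <= avg k (fun s => g (b' :: s)) + 2.
  apply: (@le_trans _ _ (avg k (fun s => g (b' :: s) + 2))).
    apply: le_avg => s ss.
    by apply: (hg [::]); rewrite /= ss.
  by rewrite avgD avg_cst.
have := diff true false; have := diff false true.
rewrite -[k.+1%:R]natr1; set x := avg k (fun s => g (false :: s)); set y := avg k (fun s => g (true :: s)).
move=> h1 h2 h3 h4.
have h5 : (x - y) ^+ 2 <= 4.
  rewrite -subr_ge0 (_ : 4 - _ = (2 - (x - y)) * (2 + (x - y))); last by ring.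
  by rewrite mulr_ge0//; lra.
rewrite (_ : ((x + y) / 2) ^+ 2 = (x ^+ 2 + y ^+ 2) / 2 - (x - y) ^+ 2 / 4); last by field.
lra.
Qed.

(** Chebyshev's inequality with the variance bound [avg_var]. *)
Lemma avg_lower_tail (R : realType) k (g : seq bool -> R) (t : R) : 0 < t ->
  (forall s1 b b' s2, size (s1 ++ b :: s2) = k ->
    g (s1 ++ b :: s2) <= g (s1 ++ b' :: s2) + 2) ->
  avg k (fun s => (g s < avg k g - t)%R%:R) <= k%:R / t ^+ 2.
Proof.
move=> t0 /avg_var; set m := avg k g => hv.
have : avg k (fun s => (g s - m) ^+ 2) <= k%:R.
  rewrite (@eq_avg _ _ _ (fun s => g s ^+ 2 + (- (2 * m) * g s + m ^+ 2))); last first.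
    by move=> s _; ring.
  rewrite avgD avgD avgZ avg_cst -/m; move: hv; nra.
move=> h; apply: le_trans (_ : t ^- 2 * avg k (fun s => (g s - m) ^+ 2) <= _); last first.
  by rewrite mulrC ler_pM2r// invr_gt0 exprn_gt0.
rewrite -avgZ; apply: le_avg => s _.
have [gs|_] := ltrP (g s) (m - t); last first.
  by rewrite /= mulr_ge0 ?sqr_ge0// invr_ge0 sqr_ge0.
rewrite /= -ler_pdivrMl ?invr_gt0 ?exprn_gt0// invrK mulr1.
by rewrite -[leRHS]sqrrN ler_pXn2r ?nnegrE//; lra.
Qed.

Lemma sum_delta_le1 (R : realType) (n c : nat) :
  \sum_(j < n) ((j : nat) == c)%:R <= 1 :> R.
Proof.
have [cn|nc] := ltnP c n; last first.
  by rewrite big1 => [//|j _]; case: eqP => // jc; have := ltn_ord j; lia.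
rewrite (bigD1 (Ordinal cn)) //= eqxx big1 ?addr0// => j jc.
by case: eqP => // e; move: jc; rewrite -val_eqE /= e eqxx.
Qed.

Lemma max_bias_attained (R : realType) n (s : seq bool) :
  exists u v : {ffun 'I_n -> bool}, max_bias R n s =
  \sum_(i < n) \sum_(j < n) (-1) ^+ nth false s (i * n + j) * (-1) ^+ u i * (-1) ^+ v j.
Proof.
have [_ [u [v huv]]] := classical_value_max (sign_mx R n s).
exists u, v; rewrite /max_bias huv; case: n u v {huv} => [|n] u v.
  by rewrite big_ord0 expr0n mul0r.
rewrite /xor_bias mulrA divff ?mul1r ?expf_neq0 ?pnatr_eq0//.
by apply: eq_bigr => i _; apply: eq_bigr => j _; rewrite mxE.
Qed.

(** Optimal answers for the first matrix are still available for the second, and at most one summand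
    changes. *)
Lemma max_bias_lip (R : realType) n s1 b b' s2 :
  max_bias R n (s1 ++ b :: s2) <= max_bias R n (s1 ++ b' :: s2) + 2.
Proof.
have [u [v ->]] := max_bias_attained R n (s1 ++ b :: s2).
apply: le_trans (lerD (max_bias_ge R (s1 ++ b' :: s2) u v) (lexx 2)).
rewrite -lerBlDl -sumrB.
pose r := size s1.
(* The changed bit has row-major index [r], that is row [r %/ n] and column [r %% n]; it may also
   lie outside the matrix, hence only an inequality. *)
apply: (@le_trans _ _ (\sum_(i < n) \sum_(j < n) 2 * (i * n + j == r)%N%:R)).
  apply: ler_sum => i _; rewrite -sumrB; apply: ler_sum => j _.
  rewrite !nth_cat -/r; case: ltngtP => ijr; last first.
  - rewrite ijr subnn /=.
    by case: b; case: b'; case: (u i); case: (v j); rewrite /= ?expr0 ?expr1; lra.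
  - by rewrite (_ : (i * n + j - r = (i * n + j - r).-1.+1)%N) ?subrr ?mulr0 //=; lia.
  - by rewrite subrr mulr0.
apply: (@le_trans _ _ (\sum_(i < n) 2 * ((i : nat) == r %/ n)%N%:R)); last first.
  by rewrite -mulr_sumr -[leRHS]mulr1 ler_pM2l// sum_delta_le1.
apply: ler_sum => i _; rewrite -mulr_sumr ler_pM2l//.
have [->|/eqP ir] := eqVneq (i : nat) (r %/ n)%N.
  apply: le_trans (sum_delta_le1 R n (r %% n)); apply: ler_sum => j _.
  rewrite {2}(divn_eq r n) eqn_add2l//.
rewrite big1 // => j _; case: eqP => // e; case: ir.
by rewrite -e divnMDl ?divn_small ?addn0// (leq_ltn_trans _ (ltn_ord j)).
Qed.

Lemma max_bias_lower_tail (R : realType) n (t : R) : 0 < t ->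
  avg (n * n) (fun s => (max_bias R n s < avg (n * n) (max_bias R n) - t)%R%:R) <=
  (n * n)%:R / t ^+ 2.
Proof. by move=> t0; apply: avg_lower_tail => // *; exact: max_bias_lip. Qed.

Lemma avg_expR_row (R : realType) n (x : R) (t : nat -> bool) :
  avg n (fun y => expR (\sum_(j < n) x * ((-1) ^+ nth false y j * (-1) ^+ t j))) =
  ((expR x + expR (- x)) / 2) ^+ n.
Proof.
elim: n t => [|n IH] t; first by rewrite /= big_ord0 expR0 expr0.
rewrite /= (@eq_avg _ _ _ (fun y => expR (x * (-1) ^+ t 0%N) *
  expR (\sum_(j < n) x * ((-1) ^+ nth false y j * (-1) ^+ t j.+1)))); last first.
  by move=> s _; rewrite big_ord_recl /= expr0 mul1r expRD.
rewrite (@eq_avg _ _ (fun y => expR (\sum_(i < n.+1) x * ((-1) ^+ nth false (true :: y) i * (-1) ^+ t i)))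
  (fun y => expR (x * - (-1) ^+ t 0%N) *
  expR (\sum_(j < n) x * ((-1) ^+ nth false y j * (-1) ^+ t j.+1)))); last first.
  by move=> s _; rewrite big_ord_recl /= expr1 mulN1r expRD.
rewrite !avgZ (IH (fun j => t j.+1)) exprS -mulrDl mulrAC.
by congr (_ / _ * _); case: (t 0%N); rewrite ?expr0 ?expr1 ?opprK ?mulr1 ?mulrN1// addrC.
Qed.

Lemma avg_expR_bias (R : realType) n k (x : R) (u v : nat -> bool) :
  avg (k * n) (fun s => expR (x * \sum_(i < k) \sum_(j < n)
    (-1) ^+ nth false s (i * n + j) * (-1) ^+ u i * (-1) ^+ v j)) =
  ((expR x + expR (- x)) / 2) ^+ (k * n).
Proof.
elim: k u => [|k IH] u; first by rewrite mul0n /= big_ord0 mulr0 expR0 expr0.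
(* For the first row the sign [u 0] merges with the column signs, and the remaining rows are
   independent of it. *)
rewrite mulSn avg_cat exprD -(IH (fun i => u i.+1)) -(avg_expR_row n x (fun j => u 0%N (+) v j)).
rewrite [RHS]mulrC -avgZ; apply: eq_avg => y sy.
rewrite [RHS]mulrC -avgZ; apply: eq_avg => s ss.
rewrite -expRD big_ord_recl /= mulrDr; congr (expR (_ + _)).
  rewrite mulr_sumr; apply: eq_bigr => j _.
  by rewrite mul0n add0n nth_cat sy ltn_ord signr_addb mulrA.
congr (_ * _); apply: eq_bigr => i _; apply: eq_bigr => j _.
by rewrite nth_cat sy /bump/= add1n mulSn -addnA ltnNge leq_addr /= addKn.
Qed.

(** The exponential of the maximum is at most the sum of the exponentials over all [4 ^+ n] answer
    pairs, each of which has the same mean. *)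
Lemma avg_expR_max_bias (R : realType) n (x : R) :
  avg (n * n) (fun s => expR (x * max_bias R n s)) <=
  4 ^+ n * ((expR x + expR (- x)) / 2) ^+ (n * n).
Proof.
pose B s (u v : {ffun 'I_n -> bool}) : R := \sum_(i < n) \sum_(j < n)
  (-1) ^+ nth false s (i * n + j) * (-1) ^+ u i * (-1) ^+ v j.
apply: (@le_trans _ _ (avg (n * n) (fun s =>
    \sum_(w : {ffun 'I_n -> bool} * {ffun 'I_n -> bool}) expR (x * B s w.1 w.2)))).
  apply: le_avg => s _; have [u [v ->]] := max_bias_attained R n s.
  by rewrite (bigD1 (u, v)) //= lerDl sumr_ge0// => w _; exact: expR_ge0.
rewrite avg_sum (eq_bigr (fun=> ((expR x + expR (- x)) / 2) ^+ (n * n))); last first.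
  move=> [u v] _ /=; pose ext (f : {ffun 'I_n -> bool}) (i : nat) :=
    if insub i is Some i' then f i' else false.
  rewrite -(avg_expR_bias n n x (ext u) (ext v)); apply: eq_avg => s _.
  congr (expR (_ * _)); apply: eq_bigr => i _; apply: eq_bigr => j _.
  by rewrite /ext !valK.
rewrite sumr_const card_prod !card_ffun card_bool card_ord.
by rewrite -expnMn -[leLHS]mulr_natl natrX.
Qed.

(** The product of [expR (- (y ^+ 2 / 2))] and [expR y + expR (- y)] is nonincreasing for [0 <= y],
    because tanh y is at most y; its value at 0 is 2. *)
Lemma cosh_le (R : realType) (x : R) : 0 <= x ->
  (expR x + expR (- x)) / 2 <= expR (x ^+ 2 / 2).
Proof.
move=> x0.
have dN (y : R) : is_derive y 1 (fun y => expR (- y)) (- expR (- y)).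
  by apply: is_derive_eq; rewrite mulrN1.
have tanh_le (y : R) : 0 <= y -> expR y - expR (- y) <= y * (expR y + expR (- y)).
  move=> y0; rewrite -subr_ge0.
  pose g (y : R) := y * (expR y + expR (- y)) - (expR y - expR (- y)).
  have dg (z : R) : is_derive z 1 g (z * (expR z - expR (- z))).
    by apply: is_derive_eq; rewrite /GRing.scale /=; ring.
  rewrite -[leRHS]/(g y) (_ : 0 = g 0); last by rewrite /g oppr0 mul0r subrr subr0.
  apply: (@ger0_derive1_ndecr _ g 0 y) => // z.
  rewrite in_itv /= => /andP[z0 _]; rewrite derive1E derive_val.
    by rewrite mulr_ge0 ?subr_ge0 ?ler_expR; lra.
  by apply: continuous_subspaceT => ?; exact/differentiable_continuous/derivable1_diffP.
pose h (y : R) := - (expR (- (y ^+ 2 / 2)) * (expR y + expR (- y))).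
have dh (z : R) : is_derive z 1 h
    (expR (- (z ^+ 2 / 2)) * (z * (expR z + expR (- z)) - (expR z - expR (- z)))).
  by apply: is_derive_eq; rewrite /GRing.scale /=; field.
have : h 0 <= h x.
  apply: (@ger0_derive1_ndecr _ h 0 x) => // z.
  rewrite in_itv /= => /andP[z0 _]; rewrite derive1E derive_val.
    by rewrite mulr_ge0 ?expR_ge0// subr_ge0 tanh_le// ltW.
  by apply: continuous_subspaceT => ?; exact/differentiable_continuous/derivable1_diffP.
rewrite /h expr0n /= mul0r oppr0 expR0 mul1r lerN2 expRN.
by rewrite ler_pdivrMl ?expR_gt0//; lra.
Qed.

(** Chernoff's bound leaves the exponent [n * (2 * ln 2 - k ^+ 2 / 2)]: the entropy of the answer
    pairs is beaten as soon as [k] exceeds [2 * Num.sqrt (ln 2)]. *)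
Lemma max_bias_upper_tail (R : realType) n (eps : R) : (0 < n)%N -> 0 < eps ->
  avg (n * n) (fun s => ((2 * Num.sqrt (ln 2) + eps) * (n%:R * Num.sqrt n%:R)
     < max_bias R n s)%R%:R) <= expR (- (n%:R * (eps ^+ 2 / 2))).
Proof.
move=> n0 e0; set k := 2 * _ + eps; set r : R := n%:R.
have r0 : 0 < r by rewrite ltr0n.
have ln2 : 0 < ln (2 : R) by rewrite ln_gt0// ltr1n.
have s0 : 0 < Num.sqrt (ln (2 : R)) by rewrite sqrtr_gt0.
have k0 : 0 < k by rewrite /k; lra.
have expRMn (z : R) m : expR (z *+ m) = expR z ^+ m.
  by rewrite -mulr_natl expRM_natl.
set q := Num.sqrt r; have q0 : 0 < q by rewrite sqrtr_gt0.
have qq : q ^+ 2 = r by rewrite sqr_sqrtr// ltW.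
(* The minimizer of [x ^+ 2 / 2 * n ^+ 2 - x * k * n * q]. *)
pose x := k / q; have x0 : 0 < x by rewrite divr_gt0.
apply: (@le_trans _ _ (avg (n * n) (fun s => expR (- (x * (k * (r * q)))) *
                                       expR (x * max_bias R n s)))).
  apply: le_avg => s _; rewrite -expRD.
  case: ltrP => [h|_]; last exact: expR_ge0.
  rewrite /= -expR0 ler_expR addrC -mulrN -mulrDr mulr_ge0 ?subr_ge0//; exact: ltW.
rewrite avgZ.
apply: (@le_trans _ _ (expR (- (x * (k * (r * q)))) *
     (expR (ln 2 *+ 2 *+ n) * expR (x ^+ 2 / 2 *+ (n * n))))).
  rewrite ler_pM2l ?expR_gt0//; apply: le_trans (avg_expR_max_bias n x) _.
  have -> : expR (ln 2 *+ 2 *+ n) = 4 ^+ n :> R.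
    by rewrite !expRMn lnK ?posrE//; congr (_ ^+ n); rewrite expr2 -natrM.
  rewrite ler_pM2l ?exprn_gt0// expRMn ler_pXn2r ?nnegrE ?expR_ge0.
  - by apply: cosh_le; exact: ltW.
  - by rewrite muln_gt0 n0.
  - by rewrite divr_ge0// addr_ge0// expR_ge0.
  - by [].
rewrite -!expRD ler_expR.
have -> : x ^+ 2 / 2 *+ (n * n) = k ^+ 2 / 2 * r.
  by rewrite -mulr_natr natrM -/r /x -qq; field; rewrite gt_eqF.
have -> : x * (k * (r * q)) = k ^+ 2 * r.
  by rewrite /x; field; rewrite gt_eqF.
have -> : ln 2 *+ 2 *+ n = 2 * Num.sqrt (ln (2 : R)) ^+ 2 * r.
  by rewrite sqr_sqrtr ?(ltW ln2)// -[LHS]mulr_natr -/r; congr (_ * _); rewrite mulr_natl.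
have := mulr_gt0 (mulr_gt0 e0 s0) r0.
rewrite /k; set t := Num.sqrt _; nra.
Qed.

(** * Asymptotics *)

Section gauss_primitive.
Variable R : realType.
Local Notation J := (@gauss_integral_proof.integral0_gauss R).

Lemma gauss_prim0 : J 0 = 0.
Proof. by rewrite /gauss_integral_proof.integral0_gauss set_itv1 Rintegral_set1. Qed.

Let integrable_gauss (a b : R) :
  lebesgue_measure.-integrable `[a, b] (EFin \o @gauss_fun R).
Proof.
apply: continuous_compact_integrable => //; first exact: segment_compact.
by apply: continuous_subspaceT; exact: continuous_gauss_fun.
Qed.

Lemma continuous_gauss_prim (x : R) : 0 <= x -> {within `[0, x], continuous J}.
Proof.
move=> x0; apply: parameterized_integral_continuous => //.
Qed.

Lemma is_derive_gauss_prim (x : R) : 0 < x -> is_derive x 1 J (expR (- x ^+ 2)).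
Proof.
move=> x0; have x1 : x < x + 1 by rewrite ltrDl.
have [dJ J'] := continuous_FTC1_closed x1 (integrable_gauss _ _) x0
  (@continuous_gauss_fun R x).
by apply: DeriveDef => //; rewrite -derive1E J'.
Qed.

Lemma cvg_gauss_prim : J x @[x --> +oo] --> Num.sqrt pi / 2.
Proof.
have -> : J = fun x => Num.sqrt (J x ^+ 2).
  by apply/funext => x; rewrite sqrtr_sqr ger0_norm// gauss_integral_proof.integral0_gauss_ge0.
have -> : Num.sqrt pi / 2 = Num.sqrt (pi / 4) :> R.
  by rewrite sqrtrM ?pi_ge0// sqrtrV// (_ : 4 = 2 ^+ 2) ?sqrtr_sqr ?ger0_norm// expr2 -natrM.
by apply: continuous_cvg;
  [exact: sqrt_continuous|exact: gauss_integral_proof.cvg_integral0_gauss_sqr].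
Qed.

Lemma le_gauss_prim (x y : R) : 0 <= x -> x <= y -> J x <= J y.
Proof.
move=> x0 xy; apply: (@ger0_derive1_ndecr _ J 0 y) => //.
- move=> z; rewrite in_itv /= => /andP[z0 _].
  by have [] := is_derive_gauss_prim z0.
- move=> z; rewrite in_itv /= => /andP[z0 _].
  by have [_ dz] := is_derive_gauss_prim z0; rewrite derive1E dz expR_ge0.
- exact/continuous_gauss_prim/(le_trans x0).
Qed.

Lemma gauss_prim_le (x : R) : 0 <= x -> J x <= Num.sqrt pi / 2.
Proof.
move=> x0; have <- := cvg_lim _ cvg_gauss_prim => //.
apply: limr_ge; first by apply/cvg_ex; eexists; exact: cvg_gauss_prim.
by near=> y; apply: le_gauss_prim.
Unshelve. all: end_near. Qed.

Lemma Erf_gauss_prim (z : R) : 0 < z -> Erf z = 2 / Num.sqrt pi * J z.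
Proof.
move=> z0; rewrite /Erf (_ : `[z, 0]%classic = set0) ?Rintegral_set0 ?subr0//.
by apply: set_itv_ge; rewrite bnd_simp -ltNge.
Qed.

End gauss_primitive.

(** * The derivative of the mean sign and its comparison with a Gaussian *)

Section mean_sign_analysis.
Variable R : realType.
Local Notation J := (@gauss_integral_proof.integral0_gauss R).
Implicit Types (x p y : R) (m : nat).

(** The sum of the derivatives telescopes: [wallisS] rewrites the previous derivative with
    [wallis R m.+1], where it combines with the derivative of the new term. *)
Lemma is_derive_mean_sign m x :
  is_derive x 1 (fun p => mean_sign p m)
    ((2 * m + 1)%:R * wallis R m * (1 - x ^+ 2) ^+ m).
Proof.
elim: m => [|m IH].
  rewrite (_ : (fun p => mean_sign p 0) = id); last first.
    by apply/funext => p; rewrite /mean_sign big_ord1 expr0 wallis0 !mulr1.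
  apply: is_derive_eq.
  by rewrite muln0 add0n wallis0 expr0 !mulr1.
rewrite (_ : (fun p => mean_sign p m.+1) = (fun p => mean_sign p m +
    p * (wallis R m.+1 * (1 - p ^+ 2) ^+ m.+1))); last first.
  by apply/funext => p; rewrite /mean_sign big_ord_recr /= mulrDr.
have df : is_derive x 1 (fun p : R => 1 - p ^+ 2) (- (2 * x)).
  by apply: is_derive_eq; rewrite /GRing.scale /=; ring.
have dX : is_derive x 1 (fun p : R => (1 - p ^+ 2) ^+ m.+1)
    (m.+1%:R * (1 - x ^+ 2) ^+ m * (- (2 * x))).
  by have := is_deriveX m.+1 df; rewrite exprfctE.
have dq : is_derive x 1 (fun p : R => p * (wallis R m.+1 * (1 - p ^+ 2) ^+ m.+1))
    (wallis R m.+1 * (1 - x ^+ 2) ^+ m.+1 -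
     2 * m.+1%:R * wallis R m.+1 * x ^+ 2 * (1 - x ^+ 2) ^+ m).
  apply: is_derive_eq.
by rewrite /GRing.scale /=; ring.
apply: is_derive_eq.
have := wallisS R m; rewrite (_ : (2 * m + 2)%:R = 2 * m.+1%:R :> R); last first.
  by rewrite -natrM; congr (_%:R); lia.
rewrite (_ : (2 * m.+1 + 1)%:R = 2 * m.+1%:R + 1 :> R); last first.
  by rewrite natrD natrM.
by move=> <-; rewrite [(1 - x ^+ 2) ^+ m.+1]exprS; ring.
Qed.

Lemma subX_le (a b : R) m : 0 <= b -> b <= a -> a <= 1 ->
  a ^+ m - b ^+ m <= m%:R * (a - b).
Proof.
move=> b0 ba a1; elim: m => [|m IH]; first by rewrite !expr0 subrr mul0r.
have bm0 : 0 <= b ^+ m by rewrite exprn_ge0.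
have bm1 : b ^+ m <= 1 by rewrite exprn_ile1// (le_trans ba).
have bam : b ^+ m <= a ^+ m by rewrite lerXn2r ?nnegrE// (le_trans b0).
by rewrite !exprS -natr1; nra.
Qed.

Lemma one_sub_le_expR m (x : R) : 0 <= x -> x <= 1 -> (1 - x) ^+ m <= expR (- (m%:R * x)).
Proof.
move=> x0 x1; rewrite -mulrN expRM_natl lerXn2r ?nnegrE ?expR_ge0//; first by lra.
exact: expR_ge1Dx.
Qed.

Lemma expR_sub_le m (x : R) : 0 <= x -> x <= 1 ->
  expR (- (m%:R * x)) - m%:R * x ^+ 2 <= (1 - x) ^+ m.
Proof.
move=> x0 x1.
(* Since [(1 - x + x ^+ 2) * (1 + x) = 1 + x ^+ 3] is at least 1 and [1 + x <= expR x]. *)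
have e1 : expR (- x) <= 1 - x + x ^+ 2.
  have B0 : 0 <= 1 - x + x ^+ 2 by nra.
  rewrite expRN -div1r ler_pdivrMr ?expR_gt0//.
  apply: (@le_trans _ _ ((1 - x + x ^+ 2) * (1 + x))).
    have := exprn_ge0 3 x0; rewrite !exprS expr0; lra.
  by rewrite ler_wpM2l// expR_ge1Dx.
rewrite -mulrN expRM_natl lerBlDr -lerBlDl.
apply: le_trans (@subX_le (expR (- x)) (1 - x) m _ _ _) _.
- by lra.
- exact: expR_ge1Dx.
- by rewrite -expR0 ler_expR; lra.
- by rewrite ler_wpM2l//; lra.
Qed.

End mean_sign_analysis.

(** * Asymptotics of the central binomial coefficient *)

Section central_binomial_asymptotics.
Variable R : realType.
Local Notation J := (@gauss_integral_proof.integral0_gauss R).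
Implicit Types (x y : R) (m : nat).

Lemma gauss_prim_le_id x : 0 <= x -> J x <= x.
Proof.
move=> x0; have : 0 - J 0 <= x - J x.
  apply: (@ger0_derive1_ndecr _ (fun x => x - J x) 0 x) => //.
  - move=> z; rewrite in_itv /= => /andP[z0 _].
    by have dz := is_derive_gauss_prim z0; apply: derivableB.
  - move=> z; rewrite in_itv /= => /andP[z0 _].
    have dz := is_derive_gauss_prim z0.
    by rewrite derive1E derive_val subr_ge0 -expR0 ler_expR oppr_le0 sqr_ge0.
  - move=> z; apply: cvgB; first by apply: continuous_subspaceT => ?.
    exact: continuous_gauss_prim.
by rewrite gauss_prim0 subr0 subr_ge0.
Qed.

Lemma gauss_prim_neg x : x < 0 -> J x = 0.
Proof.
move=> x0; rewrite /gauss_integral_proof.integral0_gauss set_itv_ge ?Rintegral_set0//.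
by rewrite bnd_simp -ltNge.
Qed.

Lemma continuous_gauss_prim_pt x : 0 <= x -> {for x, continuous J}.
Proof.
rewrite le_eqVlt => /predU1P[<-|x0]; last first.
  have dx := is_derive_gauss_prim x0.
  by apply/differentiable_continuous/derivable1_diffP.
change (J x @[x --> (0 : R)] --> J 0); rewrite gauss_prim0.
clear x; apply/cvgr0Pnorm_le => e e0; near=> x.
have [x0|x0] := ltrP x 0; first by rewrite gauss_prim_neg// normr0 ltW.
rewrite ger0_norm ?gauss_integral_proof.integral0_gauss_ge0//.
apply: le_trans (gauss_prim_le_id x0) _; apply: le_trans (ler_norm _) _.
by near: x; apply: (@cvgr0_norm_le _ _ _ _ _ id).
Unshelve. all: end_near. Qed.

(** The scale for which [mean_sign x m] is close to [wallis_ratio m * J (Num.sqrt m%:R * x)]: the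
    two have the same derivative at 0, up to the one-sidedness of [J]. *)
Definition wallis_ratio m : R := (2 * m + 1)%:R * wallis R m / Num.sqrt m%:R.
Local Notation W := wallis_ratio.

Lemma wallis_ratio_ge0 m : 0 <= W m.
Proof. by rewrite divr_ge0 ?sqrtr_ge0// mulr_ge0// ltW// wallis_gt0. Qed.

Lemma wallis_ratioK m : (0 < m)%N -> W m * Num.sqrt m%:R = (2 * m + 1)%:R * wallis R m.
Proof. by move=> m0; rewrite divfK// gt_eqF// sqrtr_gt0 ltr0n. Qed.

Let continuous_mean_sign m x : {for x, continuous (fun p => mean_sign p m)}.
Proof.
have dx := is_derive_mean_sign m x.
by apply/differentiable_continuous/derivable1_diffP.
Qed.

Let continuous_gauss_prim_scale m x : 0 <= x ->
  {for x, continuous (fun x => J (Num.sqrt m%:R * x))}.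
Proof.
move=> x0; apply: (@continuous_comp _ _ _ (fun x => Num.sqrt m%:R * x) J).
  by apply: cvgMr.
by apply: continuous_gauss_prim_pt; rewrite mulr_ge0// sqrtr_ge0.
Qed.

Let is_derive_gauss_prim_scale m x : (0 < m)%N -> 0 < x ->
  is_derive x 1 (fun x => W m * J (Num.sqrt m%:R * x))
    ((2 * m + 1)%:R * wallis R m * expR (- (m%:R * x ^+ 2))).
Proof.
move=> m0 x0; have s0 : 0 < Num.sqrt (m%:R : R) by rewrite sqrtr_gt0 ltr0n.
have d1 : is_derive x 1 (fun x => Num.sqrt m%:R * x : R) (Num.sqrt m%:R).
  by apply: is_derive_eq; rewrite /GRing.scale /=; ring.
have d2 := is_derive1_comp (is_derive_gauss_prim (mulr_gt0 s0 x0)) d1.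
rewrite (_ : (fun x => _) = (fun x => W m * (J \o (fun x => Num.sqrt m%:R * x)) x))//.
apply: is_derive_eq.
rewrite /GRing.scale /= exprMn sqr_sqrtr ?ler0n// -wallis_ratioK//; ring.
Qed.

Lemma mean_sign_le m x : (0 < m)%N -> 0 <= x -> x <= 1 ->
  mean_sign x m <= W m * J (Num.sqrt m%:R * x).
Proof.
move=> m0 x0 x1.
pose g y := W m * J (Num.sqrt m%:R * y) - mean_sign y m.
have dg (z : R) : 0 < z -> is_derive z 1 g ((2 * m + 1)%:R * wallis R m *
    expR (- (m%:R * z ^+ 2)) - (2 * m + 1)%:R * wallis R m * (1 - z ^+ 2) ^+ m).
  move=> z0; have d1 := is_derive_gauss_prim_scale m0 z0.
  by have d2 := is_derive_mean_sign m z; apply: is_deriveB.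
have : g 0 <= g x.
  apply: (@ger0_derive1_ndecr _ g 0 x _ _ _ 0 x (lexx _) x0 (lexx _)).
  - by move=> z; rewrite in_itv /= => /andP[z0 _]; have [] := dg z z0.
  - move=> z; rewrite in_itv /= => /andP[z0 zx]; have dz := dg z z0.
    rewrite derive1E derive_val -mulrBr mulr_ge0//.
      by rewrite mulr_ge0// ltW// wallis_gt0.
    by rewrite subr_ge0 one_sub_le_expR// ?sqr_ge0// expr_le1//; lra.
  - apply: continuous_in_subspaceT => z; rewrite inE /= in_itv /= => /andP[z0 _].
    apply: cvgB; last exact: continuous_mean_sign.
    by apply: cvgMr; exact: continuous_gauss_prim_scale.
by rewrite /g mulr0 gauss_prim0 mulr0 /mean_sign mul0r subr0 subr_ge0.
Qed.

Lemma mean_sign_ge m x : (0 < m)%N -> 0 <= x -> x <= 1 ->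
  W m * (J (Num.sqrt m%:R * x) - m%:R * Num.sqrt m%:R * x ^+ 5) <= mean_sign x m.
Proof.
(* A bound, uniform on the interval from 0 to [x], for the gap between the two derivatives given by
   [expR_sub_le]; integrated, it costs [c * x]. *)
move=> m0 x0 x1; pose c := (2 * m + 1)%:R * wallis R m * (m%:R * x ^+ 4).
pose g y := mean_sign y m + c * y - W m * J (Num.sqrt m%:R * y).
have dg (z : R) : 0 < z -> is_derive z 1 g ((2 * m + 1)%:R * wallis R m * (1 - z ^+ 2) ^+ m
   + c - (2 * m + 1)%:R * wallis R m * expR (- (m%:R * z ^+ 2))).
  move=> z0; have d1 := is_derive_gauss_prim_scale m0 z0.
  have d2 := is_derive_mean_sign m z; apply: is_deriveB.
  apply: is_deriveD; apply: is_derive_eq.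
  by rewrite /GRing.scale /=; ring.
have : g 0 <= g x.
  apply: (@ger0_derive1_ndecr _ g 0 x _ _ _ 0 x (lexx _) x0 (lexx _)).
  - by move=> z; rewrite in_itv /= => /andP[z0 _]; have [] := dg z z0.
  - move=> z; rewrite in_itv /= => /andP[z0 zx]; have dz := dg z z0.
    rewrite derive1E derive_val /c -mulrDr -mulrBr mulr_ge0//.
      by rewrite mulr_ge0// ltW// wallis_gt0.
    have := @expR_sub_le R m (z ^+ 2) (sqr_ge0 _) _.
    rewrite expr_le1 ?(ltW z0)// -exprM => h.
    have {h} := h (ltW (lt_le_trans zx x1)).
    have : m%:R * z ^+ 4 <= m%:R * x ^+ 4.
      by rewrite ler_wpM2l// lerXn2r ?nnegrE// ltW.
    by rewrite -[(2 * 2)%N]/4%N; lra.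
  - apply: continuous_in_subspaceT => z; rewrite inE /= in_itv /= => /andP[z0 _].
    apply: cvgB; last by apply: cvgMr; exact: continuous_gauss_prim_scale.
    by apply: cvgD; [exact: continuous_mean_sign|exact: cvgMr].
rewrite /g !mulr0 gauss_prim0 mulr0 /mean_sign mul0r addr0 subr0 subr_ge0 -/(mean_sign x m).
rewrite /c -wallis_ratioK// => h; rewrite mulrBr lerBlDr; apply: le_trans h _.
by rewrite le_eqVlt; apply/orP; left; apply/eqP; ring.
Qed.

Lemma mean_sign1 m : mean_sign 1 m = 1 :> R.
Proof.
rewrite /mean_sign expr1n subrr big_ord_recl wallis0 expr0 big1 ?addr0 ?mulr1//.
by move=> i _; rewrite expr0n mulr0.
Qed.

Lemma mean_sign_le1 m x : 0 <= x -> x <= 1 -> mean_sign x m <= 1.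
Proof.
move=> x0 x1; rewrite -(mean_sign1 m).
have dm z := is_derive_mean_sign m z.
apply: (@ger0_derive1_ndecr _ (fun p => mean_sign p m) 0 1) => // z.
  rewrite in_itv /= => /andP[z0 z1]; rewrite derive1E derive_val.
  rewrite !mulr_ge0 ?(ltW (wallis_gt0 _ _))// exprn_ge0// subr_ge0 expr_le1//; lra.
by apply: continuous_subspaceT => y; exact: continuous_mean_sign.
Qed.

Let L : R := 2 / Num.sqrt pi.
Let sqrtpi_gt0 : 0 < Num.sqrt pi :> R. Proof. by rewrite sqrtr_gt0 pi_gt0. Qed.
Let L_gt0 : 0 < L. Proof. by rewrite divr_gt0. Qed.

(* [mean_sign 1 m = 1] and the Gauss integral take the place of Stirling. *)
Lemma wallis_ratio_ge m : (0 < m)%N -> L <= W m.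
Proof.
move=> m0; have := mean_sign_le m0 ler01 (lexx 1).
rewrite mean_sign1 mulr1 => h.
have hJ : J (Num.sqrt m%:R) <= L^-1.
  by rewrite /L invf_div gauss_prim_le// sqrtr_ge0.
have := le_trans h (ler_wpM2l (wallis_ratio_ge0 m) hJ).
by rewrite ler_pdivlMr// mul1r.
Qed.

(** [mean_sign_ge] at the point [y / Num.sqrt m%:R], where the mean sign is at most 1; for fixed [y]
    the error vanishes as [m] grows. *)
Lemma wallis_ratio_le m y : 0 <= y -> y ^+ 2 <= m%:R -> (0 < m)%N ->
  W m * (J y - y ^+ 5 / m%:R) <= 1.
Proof.
move=> y0 ym m0; set s : R := Num.sqrt m%:R.
have s0 : 0 < s by rewrite sqrtr_gt0 ltr0n.
have ss : s ^+ 2 = m%:R by rewrite sqr_sqrtr.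
have ys0 : 0 <= y / s by rewrite divr_ge0// ltW.
have ys1 : y / s <= 1.
  by rewrite ler_pdivrMr// mul1r -(ler_pXn2r (n := 2)) ?nnegrE ?(ltW s0)// ss.
have := le_trans (mean_sign_ge m0 ys0 ys1) (mean_sign_le1 m ys0 ys1).
rewrite -/s mulrCA divff ?gt_eqF// mulr1; apply: le_trans.
rewrite le_eqVlt; apply/orP; left; apply/eqP; congr (_ * (_ - _)).
by rewrite -ss; field; rewrite gt_eqF.
Qed.

Lemma cvg_wallis_ratio : W m @[m --> \oo] --> L.
Proof.
apply/cvgrPdist_le => e e0.
have kL : (L + e)^-1 < L^-1 by rewrite ltf_pV2 ?posrE ?addr_gt0// ltrDl.
(* Any level strictly between [(L + e)^-1] and the limit [L^-1] of [J] would do: first [y] is fixed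
   with [k < J y], then [m] is taken so large that the error term fits into [k - (L + e)^-1]. *)
pose k := ((L + e)^-1 + L^-1) / 2.
have k1 : (L + e)^-1 < k by rewrite /k; lra.
have k2 : k < L^-1 by rewrite /k; lra.
have [y y0 ky] : exists2 y, 0 <= y & k < J y.
  have cJ := @cvg_gauss_prim R; rewrite (_ : _ / 2 = L^-1) in cJ; last first.
    by rewrite /L invf_div.
  near (pinfty_nbhs R) => y; exists y; first by near: y; exact: nbhs_pinfty_ge.
  by near: y; exact: (cvgr_gt _ cJ).
near=> m.
have m0 : (0 < m)%N by near: m; exact: nbhs_infty_gt.
rewrite ler0_norm ?subr_le0 ?wallis_ratio_ge// opprB lerBlDl.
have ym : y ^+ 2 <= m%:R by near: m; exact: nbhs_infty_ger.
have ym5 : y ^+ 5 / (k - (L + e)^-1) <= m%:R by near: m; exact: nbhs_infty_ger.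
have {}ym5 : y ^+ 5 / m%:R <= k - (L + e)^-1.
  move: ym5; rewrite ler_pdivrMr ?subr_gt0// => h.
  by rewrite ler_pdivrMr ?ltr0n// mulrC.
have Le : 0 < L + e by rewrite addr_gt0.
have h : W m * (L + e)^-1 <= 1.
  apply: le_trans (wallis_ratio_le y0 ym m0).
  by rewrite ler_wpM2l ?wallis_ratio_ge0//; lra.
by move: h; rewrite ler_pdivrMr// mul1r.
Unshelve. all: end_near. Qed.

End central_binomial_asymptotics.

(** * The limit of the greedy value and the constant of the lower bound *)

Section greedy_limit.
Variable R : realType.
Local Notation J := (@gauss_integral_proof.integral0_gauss R).
Local Notation W := (@wallis_ratio R).
Implicit Types (n m : nat).

Let cvg_inv : (n%:R^-1 : R) @[n --> \oo] --> (0 : R).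
Proof.
apply/cvgrPdist_le => e e0; near=> n.
rewrite sub0r normrN ger0_norm ?invr_ge0// invf_ple ?posrE//.
  by near: n; exact: nbhs_infty_ger.
by rewrite ltr0n; near: n; exact: nbhs_infty_gt.
Unshelve. all: end_near. Qed.

(** Covers both halvings in use: [n./2] from the majority bias and [n.-1./2] from the odd time of
    the closed form. *)
Let half (h : nat -> nat) := forall n, (2 * h n <= n <= 2 * h n + 2)%N.

Let cvg_half h : half h -> ((h n)%:R / n%:R : R) @[n --> \oo] --> (2^-1 : R).
Proof.
move=> hh; apply: (@squeeze_cvgr _ _ _ _ (fun n => 2^-1 - n%:R^-1) (fun=> 2^-1)).
- near=> n; have n0 : 0 < n%:R :> R.
    by rewrite ltr0n; near: n; exact: nbhs_infty_gt.
  have /andP[h1 h2] := hh n; apply/andP; split; last first.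
    rewrite ler_pdivrMr// ler_pdivlMl// -natrM ler_nat//.
  rewrite ler_pdivlMr// mulrBl mulVf ?gt_eqF//.
  by move: h2; rewrite -(ler_nat R) natrD natrM; lra.
- by rewrite -[X in _ --> X]subr0; apply: cvgB => //; exact: cvg_cst.
- exact: cvg_cst.
Unshelve. all: end_near. Qed.

Let cvg_half_oo h : half h -> h n @[n --> \oo] --> \oo.
Proof.
move=> hh; apply/cvgnyPge => k; near=> n.
have /andP[_ h2] := hh n.
have : (2 * k + 2 <= n)%N by near: n; exact: nbhs_infty_ge.
by move: h2; lia.
Unshelve. all: end_near. Qed.

Let half1 : half (fun n => n./2).
Proof. by move=> n; lia. Qed.

Let half2 : half (fun n => n.-1./2).
Proof. by move=> n; lia. Qed.

Let L : R := 2 / Num.sqrt pi.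
Let mu : R := L * Num.sqrt 2^-1.

Let cvg_ratio h : half h -> W (h n) @[n --> \oo] --> L.
Proof. by move=> hh; apply: cvg_comp (cvg_half_oo hh) (@cvg_wallis_ratio R). Qed.

Let cvg_sqrt h : half h ->
  (Num.sqrt (h n)%:R / Num.sqrt n%:R : R) @[n --> \oo] --> (Num.sqrt 2^-1 : R).
Proof.
move=> hh.
rewrite (_ : (fun n => _) = (fun n => Num.sqrt ((h n)%:R / n%:R))); last first.
  by apply/funext => n; rewrite sqrtrM// sqrtrV.
by apply: continuous_cvg; [exact: sqrt_continuous|exact: cvg_half].
Qed.

Let cvg_inv_sqrt : ((Num.sqrt n%:R)^-1 : R) @[n --> \oo] --> (0 : R).
Proof.
rewrite (_ : (fun n => _) = (fun n => Num.sqrt (n%:R^-1))); last first.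
  by apply/funext => n; rewrite sqrtrV.
rewrite -[X in _ --> X](sqrtr0 R).
by apply: continuous_cvg; [exact: sqrt_continuous|exact: cvg_inv].
Qed.

Let bias n : R := wallis R n./2.
Let alpha n : R := bias n * Num.sqrt n%:R.

Let cvg_alpha : alpha n @[n --> \oo] --> mu.
Proof.
have : (W n./2 * (Num.sqrt (n./2)%:R / Num.sqrt n%:R) /
    (2 * ((n./2)%:R / n%:R) + n%:R^-1)) @[n --> \oo] --> mu / (2 * 2^-1 + 0).
  apply: cvgM; last first.
    apply: cvgV; first by rewrite addr0 divff// oner_neq0.
    by apply: cvgD => //; apply: cvgMr; exact: cvg_half.
  by apply: cvgM; [exact: cvg_ratio|exact: cvg_sqrt].
rewrite addr0 divff// divr1; apply: cvg_trans; apply: near_eq_cvg.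
near=> n.
have n0 : (0 < n./2)%N by have : (2 <= n)%N; [near: n; exact: nbhs_infty_ge|lia].
have n1 : (0 < n)%N by near: n; exact: nbhs_infty_gt.
rewrite /alpha /bias.
have : W n./2 * Num.sqrt (n./2)%:R = (2 * (n./2)%:R + 1) * wallis R n./2.
  by rewrite wallis_ratioK// natrD natrM.
have ss : Num.sqrt (n%:R : R) ^+ 2 = n%:R by rewrite sqr_sqrtr.
have s0 : 0 < Num.sqrt (n%:R : R) by rewrite sqrtr_gt0 ltr0n.
move=> e; rewrite [W _ * (_ / _)]mulrA e.
move: ss s0; set s := Num.sqrt n%:R; clearbody s => ss s0; rewrite -ss; field.
rewrite gt_eqF//= gt_eqF// addr_gt0// mulr_gt0// ltr0n//.
Unshelve. all: end_near. Qed.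

(** The closed form [lindley_odd] divided by [Num.sqrt n%:R], with the mean sign and the power
    replaced by their Gaussian lower bounds. It is arranged so that every factor converges: [A] to
    1, [B] to 1/2, [gamma] to [Num.sqrt 2^-1] and [tau] to 0. *)
Let greedy_lower n : R :=
  let m := n.-1./2 in
  let A := 2 * (m%:R / n%:R) + n%:R^-1 in
  let B := m%:R / n%:R + n%:R^-1 in
  let gamma := Num.sqrt m%:R / Num.sqrt n%:R in
  let tau := (Num.sqrt n%:R)^-1 in
  (A * alpha n + W m * gamma *
     (expR (- (alpha n ^+ 2 * B)) - alpha n ^+ 4 * B * tau ^+ 2) +
   (A * alpha n + (alpha n)^-1) *
     (W m * (J (gamma * alpha n) - gamma ^+ 3 * alpha n ^+ 5 * tau ^+ 2)) - tau) / 2.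

Let pi0 : 0 < Num.sqrt pi :> R. Proof. by rewrite sqrtr_gt0 pi_gt0. Qed.
Let sqrt2V : Num.sqrt 2^-1 = (Num.sqrt 2)^-1 :> R. Proof. exact: sqrtrV. Qed.
Let sqrt2 : 0 < Num.sqrt 2 :> R. Proof. by rewrite sqrtr_gt0. Qed.
Let mu0 : 0 < mu.
Proof. by rewrite /mu /L sqrt2V mulr_gt0 ?divr_gt0 ?invr_gt0. Qed.

(** The right-hand side keeps the shape of [greedy_lower], trivial factors included, so that the
    limit can be taken factor by factor. *)
Let lower_constE : lower_const R =
  (1 * mu + L * Num.sqrt 2^-1 * (expR (- (mu ^+ 2 * 2^-1)) - mu ^+ 4 * 2^-1 * 0 ^+ 2) +
   (1 * mu + mu^-1) * (L * (J (Num.sqrt 2^-1 * mu) -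
     Num.sqrt 2^-1 ^+ 3 * mu ^+ 5 * 0 ^+ 2)) - 0) / 2.
Proof.
have pp : Num.sqrt pi ^+ 2 = pi :> R by rewrite sqr_sqrtr// pi_ge0.
have s2 : Num.sqrt 2 ^+ 2 = 2 :> R by rewrite sqr_sqrtr.
rewrite /lower_const Erf_gauss_prim ?divr_gt0// sqrtrM// /mu /L sqrt2V.
move: pp s2 pi0 sqrt2; set t := Num.sqrt pi; set s := Num.sqrt 2.
clearbody t s => pp s2 t0 s0; rewrite -pp.
have -> : (2 / t * s^-1) ^+ 2 * 2^-1 = (t ^+ 2)^-1.
  by rewrite !exprMn !exprVn s2; field; rewrite gt_eqF.
have -> : s^-1 * (2 / t * s^-1) = 1 / t.
  have e : s^-1 ^+ 2 = 2^-1 by rewrite exprVn s2.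
  by rewrite mulrCA -expr2 e; field; rewrite gt_eqF.
rewrite expr0n !mulr0 !subr0; set E := expR _; set j := J _.
have sV : s^-1 = s / 2 by rewrite -s2; field; rewrite gt_eqF.
have -> : (2 * (s * t))^-1 = s / (4 * t).
  by rewrite !invfM sV; field; rewrite gt_eqF.
rewrite !invfM sV !invrK.
have -> : (s / 2)^-1 = s by rewrite -sV invrK.
by field; rewrite gt_eqF.
Qed.

Let cvg_lower : greedy_lower n @[n --> \oo] --> lower_const R.
Proof.
rewrite lower_constE.
have cA h : half h -> (2 * ((h n)%:R / n%:R) + n%:R^-1 : R) @[n --> \oo] --> (1 : R).
  move=> hh; suff : (2 * ((h n)%:R / n%:R) + n%:R^-1 : R) @[n --> \oo] --> (2 * 2^-1 + 0 : R).
    by rewrite addr0 divff ?pnatr_eq0.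
  by apply: cvgD => //; apply: cvgMr; exact: cvg_half.
have cB h : half h -> ((h n)%:R / n%:R + n%:R^-1 : R) @[n --> \oo] --> (2^-1 : R).
  move=> hh; rewrite -[X in _ --> X]addr0.
  by apply: cvgD => //; exact: cvg_half.
have cX (f : nat -> R) (l : R) k : f n @[n --> \oo] --> l -> f n ^+ k @[n --> \oo] --> l ^+ k.
  by move=> fl; apply: (continuous_cvg _ (@exprn_continuous _ k l) fl).
have g0 : 0 <= Num.sqrt 2^-1 * mu by rewrite mulr_ge0 ?sqrtr_ge0// ltW.
rewrite /greedy_lower /=; apply: cvgMl; apply: cvgB; last exact: cvg_inv_sqrt.
apply: cvgD.
  apply: cvgD; first by apply: cvgM; [exact: cA|exact: cvg_alpha].
  apply: cvgM.
    by apply: cvgM; [exact: cvg_ratio|exact: cvg_sqrt].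
  apply: cvgB.
    apply: continuous_cvg; first exact: continuous_expR.
    by apply: cvgN; apply: cvgM; [exact: cX|exact: cB].
  apply: cvgM; last exact: cX.
  by apply: cvgM; [exact: cX|exact: cB].
apply: cvgM.
  apply: cvgD; first by apply: cvgM; [exact: cA|exact: cvg_alpha].
  by apply: cvgV; [rewrite gt_eqF|exact: cvg_alpha].
apply: cvgM; first exact: cvg_ratio.
apply: cvgB.
  apply: (continuous_cvg _ (continuous_gauss_prim_pt g0)).
  by apply: cvgM; [exact: cvg_sqrt|exact: cvg_alpha].
apply: cvgM; last exact: cX.
by apply: cvgM; [apply: cX; exact: cvg_sqrt|exact: cX].
Qed.

Let wallis_lt1 m : (0 < m)%N -> wallis R m < 1.
Proof.
case: m => // m _; have := wallisS R m; have := wallis_le1 R m; have := wallis_gt0 R m.+1.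
rewrite !natrD; have : (0 : R) <= (2 * m)%:R by []. nra.
Qed.

Let lindley_greedy_lower n : (3 <= n)%N ->
  greedy_lower n * Num.sqrt n%:R <=
  lindley ((1 + bias n) / 2) ((1 - bias n) / 2) n 0.
Proof.
move=> n3.
have p0 : 0 < bias n by exact: wallis_gt0.
have p1 : bias n < 1 by apply: wallis_lt1; lia.
have a0 : 0 <= (1 + bias n) / 2 by lra.
have b0 : 0 <= (1 - bias n) / 2 by lra.
set m := n.-1./2; have m0 : (0 < m)%N by rewrite /m; lia.
have mono p : 0 <= (1 + p) / 2 -> 0 <= (1 - p) / 2 ->
    lindley ((1 + p) / 2) ((1 - p) / 2) (2 * m).+1 0 <=
    lindley ((1 + p) / 2) ((1 - p) / 2) n 0 :> R.
  (* For even [n] the last step is dropped, which only lowers the expectation. *)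
  have [->|->] : n = (2 * m).+1 \/ n = (2 * m).+2 by rewrite /m; lia.
    by [].
  by move=> ? ?; apply: lindleyS_ge => //; field.
apply: le_trans (mono _ a0 b0).
rewrite (@lindley_odd R (bias n) _ _ _ _ erefl erefl) ?gt_eqF//.
have p01 : 0 <= bias n ^+ 2 <= 1 by rewrite sqr_ge0 expr_le1// ltW.
have hE := @expR_sub_le R m.+1 _ (andP p01).1 (andP p01).2.
have hD := mean_sign_ge m0 (ltW p0) (ltW p1).
have w0 : 0 <= W m * Num.sqrt m%:R by rewrite mulr_ge0 ?sqrtr_ge0// wallis_ratio_ge0.
have -> : greedy_lower n * Num.sqrt n%:R = ((2 * m + 1)%:R * bias n +
    W m * Num.sqrt m%:R * (expR (- (m.+1%:R * bias n ^+ 2)) - m.+1%:R * (bias n ^+ 2) ^+ 2) +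
    ((2 * m + 1)%:R * bias n + (bias n)^-1) *
      (W m * (J (Num.sqrt m%:R * bias n) - m%:R * Num.sqrt m%:R * bias n ^+ 5)) - 1) / 2.
  rewrite /greedy_lower /alpha -/m natrD natrM -[m.+1%:R]natr1.
  have ss : Num.sqrt (n%:R : R) ^+ 2 = n%:R by rewrite sqr_sqrtr.
  have rr : Num.sqrt (m%:R : R) ^+ 2 = m%:R by rewrite sqr_sqrtr.
  have s0 : 0 < Num.sqrt (n%:R : R) by rewrite sqrtr_gt0 ltr0n; lia.
  move: ss rr s0 p0; move: (bias n) (W m) => p w.
  set s := Num.sqrt n%:R; set r := Num.sqrt m%:R; clearbody s r => ss rr s0 p0'.
  rewrite -ss -rr.
  have -> : r / s * (p * s) = r * p by field; rewrite gt_eqF.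
  have -> : (p * s) ^+ 2 * (r ^+ 2 / s ^+ 2 + (s ^+ 2)^-1) = (r ^+ 2 + 1) * p ^+ 2.
    by field; rewrite gt_eqF.
  by field; rewrite !gt_eqF.
rewrite ler_pM2r ?invr_gt0// lerD2r lerD//.
  rewrite lerD2l -wallis_ratioK// ler_wpM2l//.
by rewrite ler_wpM2l// addr_ge0 ?invr_ge0 ?mulr_ge0// ltW.
Qed.

Lemma lindley_asymptotics (eps : R) : 0 < eps -> \forall n \near \oo,
  (lower_const R - eps) * Num.sqrt n%:R <=
  lindley ((1 + wallis R n./2) / 2) ((1 - wallis R n./2) / 2) n 0.
Proof.
move=> e0; near=> n.
have n3 : (3 <= n)%N by near: n; exact: nbhs_infty_ge.
apply: le_trans (lindley_greedy_lower n3).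
rewrite ler_wpM2r ?sqrtr_ge0// ltW//.
near: n; apply: (cvgr_gt _ cvg_lower).
by rewrite ltrBlDr ltrDl.
Unshelve. all: end_near. Qed.

End greedy_limit.

(** * Transfer to the probability space *)

Lemma measurable_bigmaxr (d : measure_display) (T : measurableType d)
    (R : realType) (I : Type) (r : seq I) (g : T -> R) (F : I -> T -> R) :
  measurable_fun setT g -> (forall i, measurable_fun setT (F i)) ->
  measurable_fun setT (fun w => \big[Num.max/g w]_(i <- r) F i w).
Proof.
move=> mg mF; elim: r => [|i r IH].
  by under eq_fun do rewrite big_nil.
by under eq_fun do rewrite big_cons; exact: measurable_maxr.
Qed.

Section sign_matrix_law.
Variables (d : measure_display) (T : measurableType d) (R : realType).
Variables (P : probability T R) (n : nat) (A : 'I_n -> 'I_n -> {RV P >-> R}).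
Hypothesis hA : random_sign_matrix A.

Lemma measurable_classical_value :
  measurable_fun setT (fun w => classical_value (\matrix_(i < n, j < n) A i j w)).
Proof.
have mb u v : measurable_fun setT
    (fun w => xor_bias (\matrix_(i < n, j < n) A i j w) u v).
  apply: measurable_funM => //; apply: measurable_sum => i; apply: measurable_sum => j.
  under eq_fun do rewrite mxE.
  by apply: measurable_funM => //; exact: measurable_funM.
exact: measurable_bigmaxr.
Qed.

(** Entries beyond the prefix [s] are left unconstrained, so [cyl s] below fixes exactly the first
    [size s] entries in row-major order. *)
Let side (s : seq bool) (p : 'I_n * 'I_n) : set R :=
  [set x | (p.1 * n + p.2 < size s)%N -> x = (-1) ^+ nth false s (p.1 * n + p.2)].

Let cyl (s : seq bool) : set T :=
  \bigcap_(p in [set` [set: 'I_n * 'I_n]%SET]) (A p.1 p.2 @^-1` side s p).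

Let measurable_side (s : seq bool) p : measurable (side s p).
Proof.
rewrite /side; move: (p.1 * n + p.2)%N => k.
have [ks|ks] := boolP (k < size s)%N; last first.
  by rewrite (_ : [set x | _] = setT)//; apply/seteqP; split.
rewrite (_ : [set x | _] = [set (-1) ^+ nth false s k]); first exact: measurable_set1.
by apply/seteqP; split => x /=; [exact|move=> ->].
Qed.

Let measurable_cyl s : measurable (cyl s).
Proof.
apply: fin_bigcap_measurable; first exact: finite_finset.
by move=> p _; rewrite -[X in measurable X]setTI; apply: measurable_funP.
Qed.

Let cyl_full s : size s = (n * n)%N -> P (cyl s) = (2^-1 ^+ (n * n))%:E.
Proof.
move=> ss; rewrite /cyl (proj1 hA [set: 'I_n * 'I_n]%SET (side s)); last by move=> p _; exact: measurable_side.
rewrite (eq_bigr (fun=> (2^-1)%:E)).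
  by rewrite prodEFin prodr_const cardsT card_prod card_ord.
move=> [i j] _ /=.
have lt_ij : (i * n + j < size s)%N.
  by rewrite ss; have := ltn_ord i; have := ltn_ord j; nia.
have [h1 hN1] := proj2 hA i j.
rewrite (_ : _ @^-1` _ = [set w | A i j w = (-1) ^+ nth false s (i * n + j)]).
  by case: nth; rewrite ?expr0 ?expr1.
by apply/seteqP; split => w /=; [exact|move=> ->].
Qed.

(** The cylinders of full sign patterns are disjoint and equally likely. An inequality suffices for
    a lower bound on the probability, so outcomes with entries other than 1 and -1 are ignored. *)
Lemma avg_le_probability (E : set T) (Q : pred (seq bool)) : measurable E ->
  (forall s w, size s = (n * n)%N -> Q s ->
    (forall i j, A i j w = (-1) ^+ nth false s (i * n + j)) -> E w) ->
  ((avg (n * n) (fun s => (Q s)%:R))%:E <= P E)%E.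
Proof.
move=> mE hE.
(* The statement is relativized to a prefix [s], and the induction on the number of unread entries
   splits its cylinder by the sign of the next entry. *)
suff main k s : (size s + k = n * n)%N ->
    ((2^-1 ^+ size s * avg k (fun t => (Q (s ++ t))%:R))%:E <= P (E `&` cyl s))%E.
  have := main (n * n)%N [::] erefl; rewrite expr0 mul1r => /le_trans; apply.
  by apply: le_measure; rewrite ?inE//; exact: measurableI.
have mEc u : measurable (E `&` cyl u) by exact: measurableI.
elim: k s => [|k IH] s; rewrite ?addn0 => sk.
  rewrite /= cats0; have [Qs|_] := boolP (Q s); last by rewrite mulr0 measure_ge0.
  rewrite mulr1 sk -(cyl_full sk); apply: le_measure; rewrite ?inE// => w cw; split=> //.
  apply: (hE s) => // i j; apply: (cw (i, j)) => //=.
    by rewrite inE.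
  by rewrite sk; have := ltn_ord i; have := ltn_ord j; nia.
have n0 : (0 < n)%N by move: sk; case: (n) => //; rewrite addnS.
have lt_s : (size s < n * n)%N by rewrite -sk addnS ltnS leq_addr.
have lt_i : (size s %/ n < n)%N by rewrite ltn_divLR.
pose i0 := Ordinal lt_i; pose j0 := Ordinal (ltn_pmod (size s) n0).
have idx : (i0 * n + j0 = size s)%N by apply: esym; apply: divn_eq.
have entry b w : cyl (rcons s b) w -> A i0 j0 w = (-1) ^+ b.
  move=> cw; have h : (i0 * n + j0 < size (rcons s b))%N ->
      A i0 j0 w = (-1) ^+ nth false (rcons s b) (i0 * n + j0).
    by apply: (cw (i0, j0)); rewrite /= inE.
  by rewrite h idx ?size_rcons// nth_rcons ltnn eqxx.
have sub b : E `&` cyl (rcons s b) `<=` E `&` cyl s.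
  move=> w [Ew cw]; split=> // p _ /= ps.
  have h : (p.1 * n + p.2 < size (rcons s b))%N ->
      A p.1 p.2 w = (-1) ^+ nth false (rcons s b) (p.1 * n + p.2).
    by apply: (cw p); rewrite /= inE.
  by rewrite h ?size_rcons ?ltnS 1?ltnW// nth_rcons ps.
have disj : (E `&` cyl (rcons s false)) `&` (E `&` cyl (rcons s true)) = set0.
  apply/seteqP; split => // w [[_ /entry h0] [_ /entry h1]].
  by move: h0; rewrite h1 expr0 expr1; lra.
apply: (@le_trans _ _ (P ((E `&` cyl (rcons s false)) `|` (E `&` cyl (rcons s true))))).
  rewrite measureU//.
  have h b : (size (rcons s b) + k = n * n)%N by rewrite size_rcons addSnnS.
  apply: le_trans (leeD (IH _ (h false)) (IH _ (h true))).
  rewrite -EFinD lee_fin !size_rcons /= -mulrDr exprSr.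
  under [X in _ <= _ * (avg _ X + _)]eq_fun do rewrite cat_rcons.
  under [X in _ <= _ * (_ + avg _ X)]eq_fun do rewrite cat_rcons.
  by rewrite le_eqVlt; apply/orP; left; apply/eqP; field.
apply: le_measure; rewrite ?inE//; first exact: measurableU.
by move=> w [/sub|/sub].
Qed.

End sign_matrix_law.

Lemma normalized_max_bias (R : realType) n (s : seq bool) : (0 < n)%N ->
  Num.sqrt n%:R * classical_value (sign_mx R n s) =
  max_bias R n s / (n%:R * Num.sqrt n%:R).
Proof.
move=> n0; rewrite /max_bias.
have ss : Num.sqrt (n%:R : R) ^+ 2 = n%:R by rewrite sqr_sqrtr.
have s0 : 0 < Num.sqrt (n%:R : R) by rewrite sqrtr_gt0 ltr0n.
move: ss s0; set r := Num.sqrt n%:R; clearbody r => ss s0.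
by rewrite -ss; field; rewrite gt_eqF.
Qed.

(** Half of [eps] absorbs the convergence of the mean and half the fluctuation below it; Chebyshev
    at the scale [n * Num.sqrt n%:R] gives the first error term, Chernoff the second. *)
Lemma sign_mx_probability (R : realType) (eps : R) : 0 < eps ->
  \forall n \near \oo,
  1 - (4 / eps ^+ 2 / n%:R + expR (- (n%:R * (eps ^+ 2 / 2)))) <=
  avg (n * n) (fun s => (lower_const R - eps
    <= Num.sqrt n%:R * classical_value (sign_mx R n s)
    <= 2 * Num.sqrt (ln 2) + eps)%R%:R).
Proof.
move=> e0; have e2 : 0 < eps / 2 by rewrite divr_gt0.
near=> n.
have n0 : (0 < n)%N by near: n; exact: nbhs_infty_gt.
have rn : 0 < n%:R :> R by rewrite ltr0n.
have ss : Num.sqrt (n%:R : R) ^+ 2 = n%:R by rewrite sqr_sqrtr.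
have s0 : 0 < Num.sqrt (n%:R : R) by rewrite sqrtr_gt0.
have rs0 : 0 < n%:R * Num.sqrt n%:R :> R by rewrite mulr_gt0.
set N : R := n%:R * Num.sqrt n%:R in rs0 *.
set m := avg (n * n) (max_bias R n).
have hm : (lower_const R - eps / 2) * N <= m.
  apply: le_trans (avg_max_bias R n); rewrite /N mulrCA ler_wpM2l//.
  by near: n; exact: lindley_asymptotics.
have t0 : 0 < eps / 2 * N by rewrite mulr_gt0.
have low := max_bias_lower_tail n t0.
have up := max_bias_upper_tail n0 e0.
rewrite (_ : (n * n)%:R / _ = 4 / eps ^+ 2 / n%:R) in low; last first.
  rewrite natrM /N; move: ss s0; set r := Num.sqrt n%:R; clearbody r => ss s0'.
  by rewrite -ss; field; rewrite !gt_eqF.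
rewrite -/N in up.
rewrite lerBlDr; apply: le_trans (lerD (lexx _) (lerD low up)).
(* Pointwise union bound: the indicators of the good event and of the two tails sum to at least
   1. *)
rewrite -!avgD -[leLHS](avg_cst (n * n)); apply: le_avg => s _.
rewrite normalized_max_bias// -/N ler_pdivlMr// ler_pdivrMr//.
rewrite -/m; set F := max_bias R n s; set hi := (2 * _ + eps) * N.
case: (ltrP F (m - eps / 2 * N)) => [_|h1].
  by rewrite addrCA lerDl addr_ge0// ler0n.
case: (ltrP hi F) => [_|h2]; first by rewrite add0r lerDr ler0n.
have -> : (lower_const R - eps) * N <= F by apply: le_trans h1; lra.
by rewrite !addr0.
Unshelve. all: end_near. Qed.

Theorem theorem4 (R : realType) (d : nat -> measure_display)
    (T : forall n : nat, measurableType (d n))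
    (P : forall n : nat, probability (T n) R)
    (A : forall n : nat, 'I_n -> 'I_n -> {RV (P n) >-> R})
    (hA : forall n : nat, (1 <= n)%N -> random_sign_matrix (A n))
    (eps : R) (heps : 0 < eps) :
  (fun n : nat =>
     P n [set w : T n |
       lower_const R - eps
         <= Num.sqrt n%:R * classical_value (\matrix_(i < n, j < n) A n i j w)
         <= 2 * Num.sqrt (ln 2) + eps]) @ \oo --> 1%:E.
Proof.
pose err (n : nat) : R := 4 / eps ^+ 2 / n%:R + expR (- (n%:R * (eps ^+ 2 / 2))).
have mE n : measurable [set w : T n | lower_const R - eps
    <= Num.sqrt n%:R * classical_value (\matrix_(i < n, j < n) A n i j w)
    <= 2 * Num.sqrt (ln 2) + eps].
  have mf : measurable_fun setT (fun w : T n =>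
      Num.sqrt n%:R * classical_value (\matrix_(i < n, j < n) A n i j w)).
    by apply: measurable_funM => //; exact: measurable_classical_value.
  have := mf measurableT `[lower_const R - eps, 2 * Num.sqrt (ln 2) + eps]%classic.
  rewrite setTI => /(_ (measurable_itv _)).
  by congr measurable; apply/seteqP; split => w /=; rewrite in_itv.
apply: (@squeeze_cvge _ _ _ _ (fun n => (1 - err n)%:E) _ (fun=> 1%:E)).
- near=> n; apply/andP; split; last exact: probability_le1.
  have n1 : (1 <= n)%N by near: n; exact: nbhs_infty_gt.
  apply: (@le_trans _ _ (avg (n * n) (fun s => (lower_const R - eps
    <= Num.sqrt n%:R * classical_value (sign_mx R n s)
    <= 2 * Num.sqrt (ln 2) + eps)%R%:R))%:E).
    by rewrite lee_fin; near: n; exact: sign_mx_probability.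
  apply: (avg_le_probability (hA n n1)) => // s w ss Qs hw /=.
  rewrite (_ : \matrix_(i, j) _ = sign_mx R n s)//.
  by apply/matrixP => i j; rewrite !mxE.
- apply: cvg_EFin; first by near=> n.
  rewrite -[X in _ --> X]subr0 -[X in _ - X]addr0.
  have cinv : (n%:R^-1 : R) @[n --> \oo] --> (0 : R).
    apply/gtr0_cvgV0; last exact: cvgr_idn.
    by near=> n; rewrite ltr0n; near: n; exact: nbhs_infty_gt.
  apply: cvgB; first exact: cvg_cst.
  apply: cvgD; first by rewrite -[X in _ --> X](mulr0 (4 / eps ^+ 2)); apply: cvgMr.
  have c0 : 0 < eps ^+ 2 / 2 by rewrite divr_gt0// exprn_gt0.
  (* The exponential error is at most the reciprocal of its exponent, since [1 + x <= expR x]. *)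
  apply: (@squeeze_cvgr _ _ _ _ (fun=> 0) (fun n => n%:R^-1 * (eps ^+ 2 / 2)^-1)).
  + near=> n; rewrite expR_ge0 /= expRN -invfM lef_pV2 ?posrE ?expR_gt0//.
      by apply: le_trans (expR_ge1Dx _); rewrite lerDr.
    by rewrite mulr_gt0// ltr0n; near: n; exact: nbhs_infty_gt.
  + exact: cvg_cst.
  + by rewrite -[X in _ --> X](mul0r (eps ^+ 2 / 2)^-1); apply: cvgMl.
- exact: cvg_cst.
Unshelve. all: end_near. Qed.
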